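(* Let $\ell$ be a prime number. If $\Gamma$ is a finitely generated discrete group with pro-$\ell$ completion $\Gamma^{(\ell)}$ and profinite completion $\hat\Gamma$, then the three groups $$\Gamma^{\mathrm{un}}_{/\mathbb{Q}}\otimes_{\mathbb{Q}}\mathbb{Q}_\ell,\qquad (\Gamma^{(\ell)})^{\mathrm{un}}_{/\mathbb{Q}_\ell},\qquad \hat\Gamma^{\mathrm{un}}_{/\mathbb{Q}_\ell}$$ are all canonically isomorphic as prounipotent $\mathbb{Q}_\ell$-groups.
   Context: For a discrete group $\Gamma$ and a field $k$ of characteristic zero, the unipotent completion $\Gamma^{\mathrm{un}}_{/k}$ is a prounipotent $k$-group with a homomorphism $\theta:\Gamma\to\Gamma^{\mathrm{un}}_{/k}(k)$ such that every homomorphism $\Gamma\to U(k)$ to the $k$-rational points of a unipotent $k$-group $U$ factors uniquely through $\theta$. For a profinite group $\Gamma$, the $\ell$-adic unipotent completion $\Gamma^{\mathrm{un}}_{/\mathbb{Q}_\ell}$ is a prounipotent $\mathbb{Q}_\ell$-group with a continuous homomorphism $\theta:\Gamma\to\Gamma^{\mathrm{un}}_{/\mathbb{Q}_\ell}(\mathbb{Q}_\ell)$ such that every continuous homomorphism $\Gamma\to U(\mathbb{Q}_\ell)$, $U$ a unipotent $\mathbb{Q}_\ell$-group, factors uniquely through $\theta$. Rational points carry the $\ell$-adic (inverse limit) topology. *)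

(* Defs.v *)
From HB Require Import structures.
From mathcomp Require Import all_boot all_order all_algebra.
From mathcomp Require Import boolp classical_sets functions cardinality topology.
From mathcomp Require mpoly.

Set Implicit Arguments.
Unset Strict Implicit.
Unset Printing Implicit Defensive.

Import Order.TTheory GRing.Theory Num.Theory.
Local Open Scope classical_set_scope.
Local Open Scope ring_scope.

(* Z_p as the inverse limit of the rings Z/p^n: the n-th term of a compatible
   sequence is its own remainder modulo p^n, so it lies in [0, p^n[. *)
Section PadicIntegers.
Variables (p : nat) (p_prime : prime p).

Definition padic_compat (x : nat -> int) : Prop :=
  forall n, x n = (x n.+1 %% (p ^ n)%N)%Z.

Definition padic_int of prime p : Type := {x : nat -> int | `[< padic_compat x >]}.

Local Notation Z := (padic_int p_prime).

HB.instance Definition _ := SubType.on Z.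
HB.instance Definition _ := Choice.on Z.

Implicit Types x y z : Z.

Let q n : int := (p ^ n)%N.

Lemma padicP x n : val x n = (val x n.+1 %% q n)%Z.
Proof. by have /asboolP := valP x. Qed.

Lemma padic_mod x n : (val x n %% q n)%Z = val x n.
Proof. by rewrite padicP modz_mod. Qed.

Lemma padic_modS (a b : int) n :
  (a = b %[mod q n.+1])%Z -> (a = b %[mod q n])%Z.
Proof.
move=> /eqP; rewrite eqz_mod_dvd => ab; apply/eqP; rewrite eqz_mod_dvd.
by apply: dvdz_trans ab; rewrite dvdzE /= dvdn_exp2l.
Qed.

Fact padic_mk_subproof (f : nat -> int) :
  (forall n, f n.+1 = f n %[mod q n])%Z ->
  `[< padic_compat (fun n => (f n %% q n)%Z) >].
Proof.
move=> fP; apply/asboolP => n; rewrite -fP.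
by symmetry; apply: padic_modS; rewrite modz_mod.
Qed.

Definition padic_mk (f : nat -> int)
    (fP : forall n, (f n.+1 = f n %[mod q n])%Z) : Z := 
  exist (fun g : nat -> int => `[< padic_compat g >]) _ (padic_mk_subproof fP).

Lemma padic_eq x y : (forall n, val x n = val y n) -> x = y.
Proof. by move=> xy; apply/val_inj/funext. Qed.

Lemma padicS x n : (val x n.+1 = val x n %[mod q n])%Z.
Proof. by rewrite -padicP padic_mod. Qed.

Fact padic_add_subproof x y n :
  (val x n.+1 + val y n.+1 = val x n + val y n %[mod q n])%Z.
Proof. by rewrite -modzDm !padicS modzDm. Qed.
Fact padic_mul_subproof x y n :
  (val x n.+1 * val y n.+1 = val x n * val y n %[mod q n])%Z.
Proof. by rewrite -modzMm !padicS modzMm. Qed.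
Fact padic_opp_subproof x n : (- val x n.+1 = - val x n %[mod q n])%Z.
Proof. by rewrite -modzNm padicS modzNm. Qed.

Definition padic_cst (c : int) : Z := @padic_mk (fun=> c) (fun=> erefl).
Definition padic_add x y : Z := padic_mk (padic_add_subproof x y).
Definition padic_mul x y : Z := padic_mk (padic_mul_subproof x y).
Definition padic_opp x : Z := padic_mk (padic_opp_subproof x).

Fact padic_addA : associative padic_add.
Proof.
by move=> x y z; apply: padic_eq => n /=; rewrite modzDmr modzDml addrA.
Qed.
Fact padic_addC : commutative padic_add.
Proof. by move=> x y; apply: padic_eq => n /=; rewrite addrC. Qed.
Fact padic_add0 : left_id (padic_cst 0) padic_add.
Proof. by move=> x; apply: padic_eq => n /=; rewrite mod0z add0r padic_mod. Qed.
Fact padic_addN : left_inverse (padic_cst 0) padic_opp padic_add.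
Proof. by move=> x; apply: padic_eq => n /=; rewrite modzDml addNr. Qed.
HB.instance Definition _ := GRing.isZmodule.Build Z
  padic_addA padic_addC padic_add0 padic_addN.

Fact padic_mulA : associative padic_mul.
Proof.
by move=> x y z; apply: padic_eq => n /=; rewrite modzMmr modzMml mulrA.
Qed.
Fact padic_mulC : commutative padic_mul.
Proof. by move=> x y; apply: padic_eq => n /=; rewrite mulrC. Qed.
Fact padic_mul1 : left_id (padic_cst 1) padic_mul.
Proof.
by move=> x; apply: padic_eq => n /=; rewrite modzMml mul1r padic_mod.
Qed.
Fact padic_mulDl : left_distributive padic_mul padic_add.
Proof.
by move=> x y z; apply: padic_eq => n /=; rewrite modzMml modzDm mulrDl.
Qed.

Lemma padic_cst_eq0 (c : int) : padic_cst c = 0 -> c = 0.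
Proof.
move=> c0; have dv n : (q n %| c)%Z.
  by apply/dvdz_mod0P; move/(congr1 (fun x : Z => val x n)): c0; rewrite /= mod0z.
apply/eqP; rewrite -absz_eq0; apply: contraT; rewrite -lt0n => c_gt0.
have /(dvdn_leq c_gt0) := dv `|c|%N.
by rewrite /= leqNgt ltn_expl // prime_gt1.
Qed.

Fact padic_1neq0 : padic_cst 1 != 0 :> Z.
Proof. by apply/eqP => /padic_cst_eq0. Qed.
HB.instance Definition _ := GRing.Zmodule_isComNzRing.Build Z
  padic_mulA padic_mulC padic_mul1 padic_mulDl padic_1neq0.

Lemma padic_natE n : (n%:R : Z) = padic_cst n.
Proof.
elim: n => [//|n IHn]; rewrite -[n.+1]addn1 natrD IHn.
by apply: padic_eq => m /=; rewrite modzDm PoszD.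
Qed.

Definition padic_unit : pred Z := fun x => `[< exists y, y * x = 1 >].
Definition padic_inv x : Z :=
  if pselect (exists y, y * x = 1) is left h then projT1 (cid h) else x.

Fact padic_mulV : {in padic_unit, left_inverse 1 padic_inv *%R}.
Proof.
move=> x /asboolP ux; rewrite /padic_inv; case: pselect => // h.
exact: projT2 (cid h).
Qed.
Fact padic_unitP x y : y * x = 1 -> padic_unit x.
Proof. by move=> yx; apply/asboolP; exists y. Qed.
Fact padic_inv_out : {in [predC padic_unit], padic_inv =1 id}.
Proof.
move=> x; rewrite inE => /asboolP nx; rewrite /padic_inv.
by case: pselect.
Qed.
HB.instance Definition _ := GRing.ComNzRing_hasMulInverse.Build Z
  padic_mulV padic_unitP padic_inv_out.

Lemma padic_neq0 x : x != 0 -> exists n, ~~ (q n %| val x n)%Z.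
Proof.
move=> x0; apply: contrapT => xP; move/eqP: x0; apply.
apply: padic_eq => n /=; rewrite mod0z -padic_mod; apply/dvdz_mod0P.
by apply: contrapT => xn; apply: xP; exists n; apply/negP.
Qed.

Lemma padic_shift x n k : (val x (n + k)%N = val x n %[mod q n])%Z.
Proof.
elim: k => [|k IHk]; first by rewrite addn0.
rewrite addnS -IHk.
suff H m : (m <= n + k)%N -> (val x (n + k).+1 = val x (n + k)%N %[mod q m])%Z.
  by apply: H; rewrite leq_addr.
move=> mnk; have /eqP := padicS x (n + k); rewrite eqz_mod_dvd => dv.
apply/eqP; rewrite eqz_mod_dvd; apply: dvdz_trans dv.
by rewrite dvdzE /= dvdn_exp2l.
Qed.

Fact padic_integral x y : x * y = 0 -> (x == 0) || (y == 0).
Proof.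
move=> xy0; apply: contraT; rewrite negb_or => /andP[/padic_neq0[n xn]].
move=> /padic_neq0[m ym]; exfalso.
have {}xn : ~~ (q n %| val x (n + m)%N)%Z.
  apply: contra xn => /dvdz_mod0P; rewrite padic_shift => h.
  exact/dvdz_mod0P.
have {}ym : ~~ (q m %| val y (n + m)%N)%Z.
  apply: contra ym => /dvdz_mod0P; rewrite addnC padic_shift => h.
  exact/dvdz_mod0P.
have : (q (n + m) %| val x (n + m)%N * val y (n + m)%N)%Z.
  apply/dvdz_mod0P; move/(congr1 (fun x : Z => val x (n + m)%N)): xy0 => /=.
  by rewrite mod0z.
move: xn ym; rewrite !dvdzE abszM /=.
set a := absz _; set b := absz _ => xn ym.
have a0 : (0 < a)%N by case: a xn => //; rewrite dvdn0.
have b0 : (0 < b)%N by case: b ym => //; rewrite dvdn0.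
move: xn ym; rewrite !pfactor_dvdn ?muln_gt0 ?a0 // lognM // -!ltnNge => xn ym.
by rewrite leqNgt -addSn leq_add // ltnW.
Qed.
HB.instance Definition _ := GRing.ComUnitRing_isIntegral.Build Z padic_integral.

End PadicIntegers.

Section PadicNumbers.
Variables (p : nat) (p_prime : prime p).

(* Q_p, with the topology in which the x + p^n Z_p form a basis of
   neighbourhoods of x. *)
Definition padic : Type := {fraction padic_int p_prime}.

Local Notation Q := padic.

HB.instance Definition _ := GRing.Field.on Q.

Implicit Types x y : Q.

Local Notation "z %:F" := (@FracField.tofrac (padic_int p_prime) z : Q).

Definition padic_nbhs x : set_system Q :=
  [set A | exists n, forall z : padic_int p_prime, A (x + p%:R ^+ n * z%:F)].

HB.instance Definition _ := hasNbhs.Build Q padic_nbhs.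

Fact padic_nbhs_filter x : ProperFilter (nbhs x).
Proof.
split; first by move=> [n /(_ 0)].
split; first by exists 0%N.
- move=> A B [n An] [m Bm]; exists (n + m)%N => z; split.
    by have := An (p%:R ^+ m * z); rewrite rmorphM rmorphXn rmorph_nat mulrA -exprD.
  have := Bm (p%:R ^+ n * z).
  by rewrite rmorphM rmorphXn rmorph_nat mulrA -exprD addnC.
- by move=> A B AB [n An]; exists n => z; apply: AB.
Qed.

Fact padic_nbhs_singleton x (A : set Q) : nbhs x A -> A x.
Proof. by move=> [n /(_ 0)]; rewrite rmorph0 mulr0 addr0. Qed.

Fact padic_nbhs_nbhs x (A : set Q) : nbhs x A -> nbhs x (nbhs^~ A).
Proof.
move=> [n An]; exists n => z.
by exists n => z'; have := An (z + z'); rewrite rmorphD mulrDr addrA.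
Qed.

HB.instance Definition _ := Nbhs_isNbhsTopological.Build Q
  padic_nbhs_filter padic_nbhs_singleton padic_nbhs_nbhs.

Lemma padic_intr_eq0 (c : int) : ((c%:~R : Q) == 0) = (c == 0).
Proof.
apply/eqP/eqP => [c0|->//].
have c0' : `|c|%N%:R = 0 :> Q.
  have -> : (`|c|%N%:R : Q) = (`|c|%N%:Z)%:~R by [].
  by rewrite abszE; case: (ger0P c) => _; rewrite ?rmorphN /= c0 ?oppr0.
move/eqP: c0'; rewrite -(rmorph_nat (@FracField.tofrac (padic_int p_prime))).
rewrite tofrac_eq0 padic_natE => /eqP/padic_cst_eq0 [] /eqP.
by rewrite absz_eq0 => /eqP.
Qed.

(* In the library [ratr] is a morphism only into a [numFieldType], which Q_p
   is not; the two proofs below are adapted from there. *)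
Definition padic_of_rat (a : rat) : Q := ratr a.

Let nz_den (a : rat) : (denq a)%:~R != 0 :> Q.
Proof. by rewrite padic_intr_eq0 denq_eq0. Qed.

Fact padic_of_rat_zmod_morphism : zmod_morphism padic_of_rat.
Proof.
have injZtoQ: @injective rat int intr by apply: intr_inj.
move=> x y; rewrite /padic_of_rat.
apply: (canLR (mulfK (nz_den _))); apply: (mulIf (nz_den x)).
rewrite mulrAC mulrBl divfK ?nz_den // mulrAC -!rmorphM.
apply: (mulIf (nz_den y)); rewrite mulrAC mulrBl divfK ?nz_den //.
rewrite -!(rmorphM, rmorphB); congr _%:~R; apply: injZtoQ.
rewrite !(rmorphM, rmorphB) /= [_ - _]lock /= -lock !numqE.
by rewrite (mulrAC y) -!mulrBl -mulrA mulrAC !mulrA.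
Qed.

Fact padic_of_rat_monoid_morphism : monoid_morphism padic_of_rat.
Proof.
have injZtoQ: @injective rat int intr by apply: intr_inj.
split=> [|x y]; first by rewrite /padic_of_rat /ratr divr1.
rewrite /padic_of_rat /ratr mulrC mulrAC; apply: canLR (mulKf (nz_den _)) _; rewrite !mulrA.
do 2!apply: canRL (mulfK (nz_den _)) _; rewrite -!rmorphM; congr _%:~R.
apply: injZtoQ; rewrite !rmorphM [x * y]lock /= !numqE -lock.
by rewrite -!mulrA mulrA mulrCA -!mulrA (mulrCA y).
Qed.

HB.instance Definition _ := GRing.isZmodMorphism.Build rat Q padic_of_rat
  padic_of_rat_zmod_morphism.
HB.instance Definition _ := GRing.isMonoidMorphism.Build rat Q padic_of_rat
  padic_of_rat_monoid_morphism.

End PadicNumbers.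

Section GroupMorphisms.
Variables (G H : groupType) (f : {multiplicative G -> H}).
Local Open Scope group_scope.

Lemma ghom1 : f 1 = 1.
Proof. by apply: (mulgI (f 1)); rewrite -gmulfM !mulg1. Qed.

Lemma ghomV x : f x^-1 = (f x)^-1.
Proof. by apply: (mulgI (f x)); rewrite -gmulfM !mulgV ghom1. Qed.

End GroupMorphisms.

Section GroupFunctors.

(* Group-valued functors on commutative k-algebras. The library's algebras are
   nonzero, which loses nothing: an affine scheme has one point over 0. *)
Record grpFunctor (k : fieldType) := GrpFunctor {
  gf_obj :> comAlgType k -> groupType;
  gf_map : forall R S : comAlgType k,
    {lrmorphism R -> S} -> {multiplicative gf_obj R -> gf_obj S};
  gf_map_id : forall (R : comAlgType k) (h : {lrmorphism R -> R}),
    h =1 id -> gf_map h =1 id;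
  gf_map_comp : forall (R S T : comAlgType k) (h : {lrmorphism R -> S})
      (g : {lrmorphism S -> T}) (gh : {lrmorphism R -> T}),
    gh =1 g \o h -> gf_map gh =1 gf_map g \o gf_map h }.

(* Natural transformations: between representable functors these are, by the
   Yoneda lemma, the homomorphisms of affine group schemes. *)
Record gfHom (k : fieldType) (F G : grpFunctor k) := GfHom {
  gf_app :> forall R : comAlgType k, {multiplicative F R -> G R};
  gf_natural : forall (R S : comAlgType k) (h : {lrmorphism R -> S}) (x : F R),
    gf_app S (gf_map F h x) = gf_map G h (gf_app R x) }.

Definition gfIso k (F G : grpFunctor k) (f : gfHom F G) : Prop :=
  forall R : comAlgType k, bijective (f R).

End GroupFunctors.

Section RestrictionOfScalars.
Variables (k K : fieldType) (iota : {rmorphism k -> K}).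

(* a K-algebra R seen as a k-algebra through f *)
Definition restr (f : {rmorphism k -> K}) (R : comAlgType K) : Type := R.

Section Algebra.
Variable R : comAlgType K.
Local Notation Rk := (restr iota R).

HB.instance Definition _ := GRing.ComNzRing.on Rk.

Definition restr_scale (a : k) (x : Rk) : Rk := iota a *: (x : R).

Fact restr_scalerA a b v : restr_scale a (restr_scale b v) = restr_scale (a * b) v.
Proof. by rewrite /restr_scale scalerA rmorphM. Qed.
Fact restr_scale1r : left_id 1 restr_scale.
Proof. by move=> x; rewrite /restr_scale rmorph1 scale1r. Qed.
Fact restr_scalerDr : right_distributive restr_scale +%R.
Proof. by move=> a x y; rewrite /restr_scale scalerDr. Qed.
Fact restr_scalerDl v : {morph restr_scale^~ v : a b / a + b}.
Proof. by move=> a b; rewrite /restr_scale rmorphD scalerDl. Qed.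
HB.instance Definition _ := GRing.Zmodule_isLmodule.Build k Rk
  restr_scalerA restr_scale1r restr_scalerDr restr_scalerDl.

Fact restr_scalerAl (a : k) (u v : Rk) : a *: (u * v) = (a *: u) * v.
Proof. exact: (@scalerAl K R). Qed.
HB.instance Definition _ := GRing.Lmodule_isLalgebra.Build k Rk restr_scalerAl.
HB.instance Definition _ := GRing.Lalgebra_isComAlgebra.Build k Rk.

End Algebra.

Definition restr_map (R S : comAlgType K) (h : {lrmorphism R -> S}) :
  restr iota R -> restr iota S := h.

Section Morphism.
Variables (R S : comAlgType K) (h : {lrmorphism R -> S}).

Fact restr_map_zmod : zmod_morphism (restr_map h).
Proof. exact: (rmorphB h). Qed.
Fact restr_map_monoid : monoid_morphism (restr_map h).
Proof. by split; [exact: (rmorph1 h) | exact: (rmorphM h)]. Qed.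
Fact restr_map_scalable : scalable (restr_map h).
Proof. by move=> a x; exact: (linearZ_LR h (iota a) x). Qed.
HB.instance Definition _ := GRing.isZmodMorphism.Build
  (restr iota R) (restr iota S) (restr_map h) restr_map_zmod.
HB.instance Definition _ := GRing.isMonoidMorphism.Build
  (restr iota R) (restr iota S) (restr_map h) restr_map_monoid.
HB.instance Definition _ := GRing.isScalable.Build
  k (restr iota R) (restr iota S) _ (restr_map h) restr_map_scalable.

End Morphism.

(* The base change F_K of F is F_K(R) = F(R), R being seen as a k-algebra. *)
Program Definition base_change (F : grpFunctor k) : grpFunctor K :=
  @GrpFunctor K (fun R => F (restr iota R))
    (fun R S h => gf_map F (restr_map h : {lrmorphism restr iota R -> restr iota S})) _ _.
Next Obligation. by move=> F R h h1; exact: gf_map_id. Qed.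
Next Obligation. by move=> F R S T h g gh e; exact: gf_map_comp. Qed.

Definition restr_unit : k^o -> restr iota K^o := iota.
Fact restr_unit_zmod : zmod_morphism restr_unit.
Proof. exact: (rmorphB iota). Qed.
Fact restr_unit_monoid : monoid_morphism restr_unit.
Proof. by split; [exact: (rmorph1 iota) | exact: (rmorphM iota)]. Qed.
Fact restr_unit_scalable : scalable restr_unit.
Proof. by move=> a x; exact: (rmorphM iota a x). Qed.
HB.instance Definition _ := GRing.isZmodMorphism.Build
  k^o (restr iota K^o) restr_unit restr_unit_zmod.
HB.instance Definition _ := GRing.isMonoidMorphism.Build
  k^o (restr iota K^o) restr_unit restr_unit_monoid.
HB.instance Definition _ := GRing.isScalable.Build
  k k^o (restr iota K^o) _ restr_unit restr_unit_scalable.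

(* F(k) -> F(K) = F_K(K), induced by iota *)
Definition base_change_pt (F : grpFunctor k) :
    {multiplicative F k^o -> base_change F K^o} :=
  gf_map F (restr_unit : {lrmorphism k^o -> restr iota K^o}).

End RestrictionOfScalars.

Definition unitriangular (R : pzRingType) n (M : 'M[R]_n) : Prop :=
  forall i j : 'I_n, (j <= i)%N -> M i j = (i == j)%:R.

(* The value of p at M; its variables are the entries of an n x n matrix, in the
   order of mxvec. *)
Definition mx_eval (k : fieldType) (R : comAlgType k) n (p : mpoly.mpoly (n * n) k)
    (M : 'M[R]_n) : R :=
  mpoly.mmap (GRing.in_alg R) (fun i => mxvec M 0 i) p.

Definition zero_locus (k : fieldType) n (E : set (mpoly.mpoly (n * n) k)) (R : comAlgType k) :
    set 'M[R]_n :=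
  [set M | unitriangular M /\ forall p, E p -> mx_eval p M = 0].
Arguments zero_locus [k n] E R _.

(* A unipotent k-group is a closed k-subgroup of the group of upper
   unitriangular matrices of some size, i.e. a zero locus whose R-points form a
   subgroup for every R. The inverse of a matrix of determinant 1 is its
   adjugate. *)
Record unipGroup (k : fieldType) := UnipGroup {
  ug_dim : nat;
  ug_eqs : set (mpoly.mpoly (ug_dim * ug_dim) k);
  ug_1 : forall R : comAlgType k, zero_locus ug_eqs R 1%:M;
  ug_mul : forall (R : comAlgType k) (M N : 'M[R]_ug_dim),
    zero_locus ug_eqs R M -> zero_locus ug_eqs R N -> zero_locus ug_eqs R (M *m N);
  ug_inv : forall (R : comAlgType k) (M : 'M[R]_ug_dim),
    zero_locus ug_eqs R M -> zero_locus ug_eqs R (\adj M) }.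
Arguments ug_eqs [k] u _.

Section Unipotent.
Variable k : fieldType.

Section Points.
Variables (U : unipGroup k) (R : comAlgType k).

Definition ug_pt : Type := {M : 'M[R]_(ug_dim U) | `[< zero_locus (ug_eqs U) R M >]}.

HB.instance Definition _ := SubType.on ug_pt.
HB.instance Definition _ := Choice.on ug_pt.

Definition ug_mk M (h : zero_locus (ug_eqs U) R M) : ug_pt :=
  exist (fun M : 'M[R]_(ug_dim U) => `[< zero_locus (ug_eqs U) R M >]) M (asboolT h).

Lemma ug_ptP (x : ug_pt) : zero_locus (ug_eqs U) R (val x).
Proof. exact/asboolP/(valP x). Qed.

Lemma ug_det (x : ug_pt) : \det (val x) = 1.
Proof.
have [xP _] := ug_ptP x.
rewrite -det_tr det_trig; last first.
  apply/is_trig_mxP => i j ij; rewrite mxE xP 1?ltnW //.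
  by rewrite -val_eqE /= gtn_eqF.
by rewrite big1 // => i _; rewrite mxE xP // eqxx.
Qed.

Definition ug_ptM (x y : ug_pt) : ug_pt := ug_mk (ug_mul (ug_ptP x) (ug_ptP y)).
Definition ug_ptV (x : ug_pt) : ug_pt := ug_mk (ug_inv (ug_ptP x)).
Definition ug_pt1 : ug_pt := ug_mk (ug_1 U R).

Fact ug_ptA : associative ug_ptM.
Proof. by move=> x y z; apply: val_inj; exact: mulmxA. Qed.
Fact ug_pt1g : left_id ug_pt1 ug_ptM.
Proof. by move=> x; apply: val_inj; exact: mul1mx. Qed.
Fact ug_ptg1 : right_id ug_pt1 ug_ptM.
Proof. by move=> x; apply: val_inj; exact: mulmx1. Qed.
Fact ug_ptVg : left_inverse ug_pt1 ug_ptV ug_ptM.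
Proof. by move=> x; apply: val_inj; rewrite /= mul_adj_mx ug_det. Qed.
Fact ug_ptgV : right_inverse ug_pt1 ug_ptV ug_ptM.
Proof. by move=> x; apply: val_inj; rewrite /= mul_mx_adj ug_det. Qed.
HB.instance Definition _ := isGroup.Build ug_pt ug_ptA ug_pt1g ug_ptg1 ug_ptVg ug_ptgV.

End Points.

Lemma zero_locus_map (R S : comAlgType k) (h : {lrmorphism R -> S}) n
    (E : set (mpoly.mpoly (n * n) k)) (M : 'M[R]_n) :
  zero_locus E R M -> zero_locus E S (map_mx h M).
Proof.
move=> [tM EM]; split=> [i j ij|q Eq]; first by rewrite mxE tM // rmorph_nat.
rewrite -(rmorph0 h) -(EM q Eq) /mx_eval /mpoly.mmap rmorph_sum.
apply: eq_bigr => m _ /=; rewrite rmorphM /= rmorph_alg; congr (_ * _).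
rewrite /mpoly.mmap1 rmorph_prod; apply: eq_bigr => i _.
by rewrite rmorphXn -map_mxvec mxE.
Qed.

Section Map.
Variables (U : unipGroup k) (R S : comAlgType k) (h : {lrmorphism R -> S}).
Definition ug_map (x : ug_pt U R) : ug_pt U S := ug_mk (zero_locus_map h (ug_ptP x)).
Fact ug_mapM : {morph ug_map : x y / (x * y)%g}.
Proof. by move=> x y; apply: val_inj; exact: map_mxM. Qed.
HB.instance Definition _ := isMultiplicative.Build _ _ ug_map ug_mapM.
End Map.

Program Definition ug_functor (U : unipGroup k) : grpFunctor k :=
  @GrpFunctor k (fun R => ug_pt U R) (fun R S h => @ug_map U R S h) _ _.
Next Obligation.
by move=> U R h h1 x; apply: val_inj; apply/matrixP => i j; rewrite mxE h1.
Qed.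
Next Obligation.
by move=> U R S T h g gh e x; apply: val_inj; apply/matrixP => i j; rewrite !mxE e.
Qed.

End Unipotent.

Coercion ug_functor : unipGroup >-> grpFunctor.

(* A prounipotent k-group is the limit of an inverse system of unipotent
   k-groups indexed by a directed preorder. *)
Record prounipGroup (k : fieldType) := ProunipGroup {
  pu_idx : Type;
  pu_le : pu_idx -> pu_idx -> Prop;
  pu_refl : forall i, pu_le i i;
  pu_trans : forall i j l, pu_le i j -> pu_le j l -> pu_le i l;
  pu_inhab : inhabited pu_idx;
  pu_directed : forall i j, exists l, pu_le i l /\ pu_le j l;
  pu_grp : pu_idx -> unipGroup k;
  pu_tr : forall i j, pu_le i j -> gfHom (pu_grp j) (pu_grp i);
  pu_tr_id : forall i (h : pu_le i i) (R : comAlgType k), pu_tr h R =1 id;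
  pu_tr_comp : forall i j l (h : pu_le i j) (h' : pu_le j l) (h'' : pu_le i l)
      (R : comAlgType k),
    pu_tr h'' R =1 pu_tr h R \o pu_tr h' R }.
Arguments pu_grp [k] p i.

Section Prounipotent.
Variable k : fieldType.

Section Points.
Variables (G : prounipGroup k) (R : comAlgType k).

Definition pu_compat (x : forall i, pu_grp G i R) : Prop :=
  forall i j (h : pu_le i j), pu_tr h R (x j) = x i.

Definition pu_pt : Type := {x : forall i, pu_grp G i R | `[< pu_compat x >]}.

HB.instance Definition _ := SubType.on pu_pt.
HB.instance Definition _ := Choice.on pu_pt.

Definition pu_mk (x : forall i, pu_grp G i R) (h : pu_compat x) : pu_pt :=
  exist (fun x : forall i, pu_grp G i R => `[< pu_compat x >]) x (asboolT h).

Lemma pu_ptP (x : pu_pt) : pu_compat (val x).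
Proof. exact/asboolP/(valP x). Qed.

Fact pu_ptM_subproof (x y : pu_pt) : pu_compat (fun i => val x i * val y i)%g.
Proof. by move=> i j h; rewrite gmulfM !pu_ptP. Qed.
Fact pu_ptV_subproof (x : pu_pt) : pu_compat (fun i => (val x i)^-1)%g.
Proof. by move=> i j h; rewrite ghomV !pu_ptP. Qed.
Fact pu_pt1_subproof : pu_compat (fun i => 1)%g.
Proof. by move=> i j h; rewrite ghom1. Qed.

Definition pu_ptM x y : pu_pt := pu_mk (pu_ptM_subproof x y).
Definition pu_ptV x : pu_pt := pu_mk (pu_ptV_subproof x).
Definition pu_pt1 : pu_pt := pu_mk pu_pt1_subproof.

Lemma pu_pt_eq (x y : pu_pt) : (forall i, val x i = val y i) -> x = y.
Proof. by move=> xy; apply: val_inj; apply: functional_extensionality_dep. Qed.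

Fact pu_ptA : associative pu_ptM.
Proof. by move=> x y z; apply: pu_pt_eq => i; exact: mulgA. Qed.
Fact pu_pt1g : left_id pu_pt1 pu_ptM.
Proof. by move=> x; apply: pu_pt_eq => i; exact: mul1g. Qed.
Fact pu_ptg1 : right_id pu_pt1 pu_ptM.
Proof. by move=> x; apply: pu_pt_eq => i; exact: mulg1. Qed.
Fact pu_ptVg : left_inverse pu_pt1 pu_ptV pu_ptM.
Proof. by move=> x; apply: pu_pt_eq => i; exact: mulVg. Qed.
Fact pu_ptgV : right_inverse pu_pt1 pu_ptV pu_ptM.
Proof. by move=> x; apply: pu_pt_eq => i; exact: mulgV. Qed.
HB.instance Definition _ := isGroup.Build pu_pt pu_ptA pu_pt1g pu_ptg1 pu_ptVg pu_ptgV.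

End Points.

Section Map.
Variables (G : prounipGroup k) (R S : comAlgType k) (h : {lrmorphism R -> S}).
Fact pu_map_subproof (x : pu_pt G R) :
  pu_compat (fun i => gf_map (pu_grp G i) h (val x i)).
Proof. by move=> i j le_ij; rewrite gf_natural pu_ptP. Qed.
Definition pu_map (x : pu_pt G R) : pu_pt G S := pu_mk (pu_map_subproof x).
Fact pu_mapM : {morph pu_map : x y / (x * y)%g}.
Proof. by move=> x y; apply: pu_pt_eq => i; exact: gmulfM. Qed.
HB.instance Definition _ := isMultiplicative.Build _ _ pu_map pu_mapM.
End Map.

Program Definition pu_functor (G : prounipGroup k) : grpFunctor k :=
  @GrpFunctor k (fun R => pu_pt G R) (fun R S h => @pu_map G R S h) _ _.
Next Obligation.
by move=> G R h h1 x; apply: pu_pt_eq => i; exact: gf_map_id.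
Qed.
Next Obligation.
by move=> G R S T h g gh e x; apply: pu_pt_eq => i; exact: gf_map_comp.
Qed.

End Prounipotent.

Coercion pu_functor : prounipGroup >-> grpFunctor.

HB.mixin Record isTopGroup P of Group P & Topological P := {
  mulg_continuous : continuous (fun z : P * P => (z.1 * z.2)%g);
  invg_continuous : continuous (fun x : P => x^-1%g)
}.

#[short(type="topGroupType")]
HB.structure Definition TopGroup := {P of isTopGroup P & Group P & Topological P}.

Section NormalSubgroups.
Variable T : groupType.
Local Open Scope group_scope.

Definition is_subgroup (N : set T) : Prop :=
  N 1 /\ forall x y, N x -> N y -> N (x / y).

Definition is_normal (N : set T) : Prop :=
  is_subgroup N /\ forall x y, N x -> N (x ^ y).

Definition cosets (N : set T) : set (set T) :=
  [set [set g * x | x in N] | g in [set: T]].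

Definition has_index (N : set T) (m : nat) : Prop := (cosets N #= `I_m)%card.

Definition finitely_generated : Prop :=
  exists s : seq T, forall H : set T,
    is_subgroup H -> (forall x, x \in s -> H x) -> H = setT.

Definition set_mul (A B : set T) : set T := [set a * b | a in A & b in B].
Definition set_inv (A : set T) : set T := [set a^-1 | a in A].

End NormalSubgroups.

(* The inverse limit of the quotients T/N over the normal subgroups N of T whose
   index is finite and satisfies C. An element of T/N is a coset of N, and
   T/N -> T/M sends a coset of N to the coset of M that contains it. *)
Section Completion.
Variables (T : groupType) (C : nat -> Prop).
Local Open Scope group_scope.

Definition level := {N : set T | is_normal N /\ exists2 m, C m & has_index N m}.

Definition coset_compat (x : level -> set T) : Prop :=
  (forall N : level, cosets (sval N) (x N)) /\
  (forall N M : level, sval N `<=` sval M -> x N `<=` x M).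

Definition completion : Type := {x : level -> set T | `[< coset_compat x >]}.

HB.instance Definition _ := SubType.on completion.
HB.instance Definition _ := Choice.on completion.

Definition completion_mk (x : level -> set T) (h : coset_compat x) : completion :=
  exist (fun x : level -> set T => `[< coset_compat x >]) x (asboolT h).

Lemma completionP (x : completion) : coset_compat (val x).
Proof. exact/asboolP/(valP x). Qed.

Lemma level_subgroup (N : level) : is_subgroup (sval N).
Proof. by case: N => N [[]]. Qed.

Lemma levelJ (N : level) x y : sval N x -> sval N (x ^ y).
Proof. by case: N => N [[_ h] ?] /=; exact: h. Qed.

Lemma level1 (N : level) : sval N 1.
Proof. by have [] := level_subgroup N. Qed.

Lemma levelV (N : level) x : sval N x -> sval N x^-1.
Proof. by move=> Nx; have [N1 /(_ _ _ N1 Nx)] := level_subgroup N; rewrite div1g. Qed.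

Lemma levelM (N : level) x y : sval N x -> sval N y -> sval N (x * y).
Proof.
move=> Nx /levelV Ny; have [_ /(_ _ _ Nx Ny)] := level_subgroup N.
by rewrite invgK.
Qed.

Definition lcoset_of (N : level) (g : T) : set T := [set g * x | x in sval N].

Lemma mem_lcoset (N : level) g y : lcoset_of N g y <-> sval N (g^-1 * y).
Proof.
split=> [[x Nx <-]|Ny]; first by rewrite mulKg.
by exists (g^-1 * y) => //; rewrite mulVKg.
Qed.

Lemma lcoset_mul (N : level) g h :
  set_mul (lcoset_of N g) (lcoset_of N h) = lcoset_of N (g * h).
Proof.
apply/seteqP; split=> [_ [_ [a Na <-] [_ [b Nb <-] <-]]|y].
  exists (a ^ h * b); first by apply: levelM => //; exact: levelJ.
  by rewrite conjgE !mulgA mulgK.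
move=> [a Na <-]; exists g; first by exists 1; [exact: level1|exact: mulg1].
by exists (h * a); [exists a|exact: mulgA].
Qed.

Lemma lcoset_inv (N : level) g : set_inv (lcoset_of N g) = lcoset_of N g^-1.
Proof.
apply/seteqP; split=> [_ [_ [a Na <-] <-]|_ [a Na <-]].
  exists (a^-1 ^ g^-1); first exact/levelJ/levelV.
  by rewrite conjgE invgK invgM mulKg.
exists (g * a^-1 ^ g); first by exists (a^-1 ^ g) => //; exact/levelJ/levelV.
by rewrite conjgE mulVKg invgM invgK.
Qed.

Fact completion_pt_subproof g : coset_compat (fun N => lcoset_of N g).
Proof.
split=> [N|N M NM _ [a Na <-]]; first by exists g.
by exists a => //; exact: NM.
Qed.

Definition completion_of (g : T) : completion :=
  completion_mk (completion_pt_subproof g).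

Lemma completion_rep (x : completion) N : exists g, val x N = lcoset_of N g.
Proof. by have [/(_ N) [g _ <-] _] := completionP x; exists g. Qed.

Fact completion_mul_subproof (x y : completion) :
  coset_compat (fun N => set_mul (val x N) (val y N)).
Proof.
split=> [N|N M NM _ [a xa [b yb <-]]].
  have [g ->] := completion_rep x N; have [h ->] := completion_rep y N.
  by rewrite lcoset_mul; exists (g * h).
have [_ hx] := completionP x; have [_ hy] := completionP y.
by exists a; [exact: hx xa|exists b => //; exact: hy yb].
Qed.

Fact completion_inv_subproof (x : completion) :
  coset_compat (fun N => set_inv (val x N)).
Proof.
split=> [N|N M NM _ [a xa <-]].
  by have [g ->] := completion_rep x N; rewrite lcoset_inv; exists g^-1.
by have [_ hx] := completionP x; exists a => //; exact: hx xa.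
Qed.

Definition completion_mul x y := completion_mk (completion_mul_subproof x y).
Definition completion_inv x := completion_mk (completion_inv_subproof x).

Lemma completion_eq (x y : completion) : (forall N, val x N = val y N) -> x = y.
Proof. by move=> xy; apply/val_inj/funext. Qed.

Fact completion_mulA : associative completion_mul.
Proof.
move=> x y z; apply: completion_eq => N /=.
have [a ->] := completion_rep x N; have [b ->] := completion_rep y N.
by have [c ->] := completion_rep z N; rewrite !lcoset_mul mulgA.
Qed.
Fact completion_mul1 : left_id (completion_of 1) completion_mul.
Proof.
move=> x; apply: completion_eq => N /=.
by have [a ->] := completion_rep x N; rewrite lcoset_mul mul1g.
Qed.
Fact completion_mulr1 : right_id (completion_of 1) completion_mul.
Proof.
move=> x; apply: completion_eq => N /=.
by have [a ->] := completion_rep x N; rewrite lcoset_mul mulg1.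
Qed.
Fact completion_mulV : left_inverse (completion_of 1) completion_inv completion_mul.
Proof.
move=> x; apply: completion_eq => N /=.
by have [a ->] := completion_rep x N; rewrite lcoset_inv lcoset_mul mulVg.
Qed.
Fact completion_mulgV : right_inverse (completion_of 1) completion_inv completion_mul.
Proof.
move=> x; apply: completion_eq => N /=.
by have [a ->] := completion_rep x N; rewrite lcoset_inv lcoset_mul mulgV.
Qed.
HB.instance Definition _ := isGroup.Build completion completion_mulA
  completion_mul1 completion_mulr1 completion_mulV completion_mulgV.

Fact completion_ofM : {morph completion_of : x y / x * y}.
Proof. by move=> x y; apply: completion_eq => N; rewrite /= lcoset_mul. Qed.
HB.instance Definition _ := isMultiplicative.Build T completion completion_of
  completion_ofM.

(* the limit topology, with the quotients T/N discrete *)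
Definition completion_proj (x : completion) :
  prod_topology (fun=> discrete_topology (set T)) := fun N : level => val x N.

HB.instance Definition _ :=
  Topological.copy completion (initial_topology completion_proj).

Lemma continuous_to_completion (X : topologicalType) (f : X -> completion) :
  (forall N x, \forall y \near x, val (f y) N = val (f x) N) -> continuous f.
Proof.
move=> fN.
have cg : continuous (completion_proj \o f).
  move=> x; apply/cvg_sup => N U [_ [[B _ <-] xB /filterS]]; apply.
  by apply: filterS (fN N x) => y fy; rewrite /= /completion_proj /= fy.
apply/continuousP => _ [A oA <-].
by move/continuousP: cg => /(_ A oA).
Qed.

Lemma completion_nbhs (x : completion) N : \forall y \near x, val y N = val x N.
Proof.
have /cvg_sup/(_ N) cN : nbhs (completion_proj x) --> completion_proj x by [].
have cx : completion_proj @ x --> completion_proj x by exact: initial_continuous.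
apply: (cx [set g | g N = val x N]); apply: cN.
have := @initial_continuous (level -> set T) (discrete_topology (set T))
  (fun g => g N) (completion_proj x).
move=> /(_ [set A | A = val x N]); apply; exact: discrete_set1.
Qed.

Fact completion_mul_continuous :
  continuous (fun z : completion * completion => z.1 * z.2).
Proof.
apply: continuous_to_completion => N [x y].
exists ([set x' | val x' N = val x N], [set y' | val y' N = val y N]).
  by split; exact: completion_nbhs.
by move=> [x' y'] /= [-> ->].
Qed.

Fact completion_inv_continuous : continuous (fun x : completion => x^-1).
Proof.
apply: continuous_to_completion => N x.
by apply: filterS (completion_nbhs x N) => y /= ->.
Qed.

HB.instance Definition _ := isTopGroup.Build completion
  completion_mul_continuous completion_inv_continuous.

End Completion.

Definition profinite_completion (T : groupType) : topGroupType :=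
  completion T (fun=> True).

Definition pro_completion (l : nat) (T : groupType) : topGroupType :=
  completion T (fun m => exists e, m = l ^ e)%N.

Section UnipotentCompletion.

Definition factors_uniquely (k : fieldType) (T : Type) (G U : grpFunctor k)
    (theta : T -> G k^o) (phi : T -> U k^o) : Prop :=
  exists2 f : gfHom G U, (forall t, f _ (theta t) = phi t) &
    forall g : gfHom G U, (forall t, g _ (theta t) = phi t) ->
      forall R : comAlgType k, g R =1 f R.

Definition is_unip_completion (k : fieldType) (T : groupType)
    (G : prounipGroup k) (theta : {multiplicative T -> G k^o}) : Prop :=
  forall (U : unipGroup k) (phi : {multiplicative T -> U k^o}),
    factors_uniquely theta phi.

Variables (l : nat) (l_prime : prime l).
Local Notation Ql := (padic l_prime).

(* U(Q_l) with the subspace topology of the matrices over Q_l *)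
Definition ug_ladic (U : unipGroup Ql) : topologicalType :=
  initial_topology (fun x : U Ql^o => val x : 'M[Ql]_(ug_dim U)).

(* G(Q_l) with the inverse limit topology *)
Definition pu_ladic (G : prounipGroup Ql) : topologicalType :=
  initial_topology (fun x : G Ql^o =>
    (fun i => val x i) : prod_topology (fun i => ug_ladic (pu_grp G i))).

Definition is_ladic_unip_completion (P : topGroupType)
    (G : prounipGroup Ql) (theta : {multiplicative P -> G Ql^o}) : Prop :=
  continuous (theta : P -> pu_ladic G) /\
  forall (U : unipGroup Ql) (phi : {multiplicative P -> U Ql^o}),
    continuous (phi : P -> ug_ladic U) -> factors_uniquely theta phi.

End UnipotentCompletion.

Definition canonical_iso (k : fieldType) (T : Type) (F G : grpFunctor k)
    (a : T -> F k^o) (b : T -> G k^o) (f : gfHom F G) : Prop :=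
  [/\ gfIso f, forall t, f _ (a t) = b t &
      forall g : gfHom F G, gfIso g -> (forall t, g _ (a t) = b t) ->
        forall R : comAlgType k, g R =1 f R].

(* Main.v *)
(* Let M be the limit of the Zariski closures of the images of T under all its
   unitriangular representations over k = Q, taken over K = Q_l. Every
   unitriangular representation phi of T over K is a K-linear image of one over
   k: as T is finitely generated, the k-span of phi(T) is finite dimensional,
   and T acts unipotently on it. Hence M receives the universal homomorphism
   from T. Its points over K-algebras are the homomorphisms from the ring of
   functions t |-> p(rho(t)) on T, so a natural transformation out of M is
   determined by its values on T (Yoneda).
   Over k the same construction gives G, hence M is the base change of G. Over K,
   a unitriangular representation of T is integral up to conjugation by a
   diagonal matrix, and modulo l^m it has an l-group as image; it therefore
   extends uniquely to a continuous representation of the pro-l and of the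
   profinite completion, so M also represents the l-adic unipotent completions. *)
From HB Require Import structures.
Require Import Defs.
From mathcomp Require Import all_boot all_order all_algebra.
From mathcomp Require Import fingroup perm gproduct zmodp.
From mathcomp Require Import boolp classical_sets functions cardinality topology.
From mathcomp Require Import ring.
From mathcomp Require mpoly.
Import (canonicals, coercions) mpoly.
From mathcomp Require Import generic_quotient fraction.

Set Implicit Arguments.
Unset Strict Implicit.
Unset Printing Implicit Defensive.

Import Order.TTheory GRing.Theory Num.Theory.
Local Open Scope classical_set_scope.
Local Open Scope ring_scope.

(** * Polynomial functions and Zariski density *)

(** The universal property of [G] concerns homomorphisms over the small field and does not speak of
    its base change, so the comparison needs an explicit group whose base change can be computed.
    This is why the model is indexed by representations over the small field even when its groups
    live over the large one. Zariski closures over the two fields are cut out by different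
    equations, and group laws have to be checked on points over arbitrary algebras. Both
    difficulties are settled by one density statement, in which the polynomials may have
    coefficients in the algebra where the points live. Homomorphisms from the model to unipotent
    groups are built so as to be linear in the matrix entries of a single representation. This is
    recorded on purpose: linearity gives continuity for the l-adic topology, which is what carries
    an equality from T to its completions. *)

Section PolynomialFunctions.
Variables (R : comNzRingType) (n : nat).
Local Notation poly_n := (mpoly.mpoly (n * n) R).

Definition mx_peval (p : poly_n) (M : 'M[R]_n) : R :=
  mpoly.mmap idfun (fun i => mxvec M 0 i) p.

(** Coefficients are taken in the ring of the points, not in a base field, so that multiplication by
    a fixed point is still polynomial. *)
Definition polyfun (F : 'M[R]_n -> R) : Prop :=
  exists p : poly_n, forall M, F M = mx_peval p M.

Lemma polyfun_ext F G : F =1 G -> polyfun F -> polyfun G.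
Proof. by move=> FG [p Fp]; exists p => M; rewrite -FG Fp. Qed.

Lemma polyfun_cst a : polyfun (fun=> a).
Proof. by exists (mpoly.mpolyC _ a) => M; rewrite /mx_peval mpoly.mmapC. Qed.

Lemma polyfun_coord i j : polyfun (fun M => M i j).
Proof.
exists (mpoly.mpolyX R (mpoly.mnm1 (mxvec_index i j))) => M.
by rewrite /mx_peval mpoly.mmapX mpoly.mmap1U mxvecE.
Qed.

Lemma polyfunD F G : polyfun F -> polyfun G -> polyfun (fun M => F M + G M).
Proof. by move=> [p Fp] [q Gq]; exists (p + q) => M; rewrite /mx_peval rmorphD Fp Gq. Qed.

Lemma polyfunM F G : polyfun F -> polyfun G -> polyfun (fun M => F M * G M).
Proof. by move=> [p Fp] [q Gq]; exists (p * q) => M; rewrite /mx_peval rmorphM Fp Gq. Qed.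

Lemma polyfunB F G : polyfun F -> polyfun G -> polyfun (fun M => F M - G M).
Proof. by move=> [p Fp] [q Gq]; exists (p - q) => M; rewrite /mx_peval rmorphB Fp Gq. Qed.

Lemma polyfun_sum I (r : seq I) (F : I -> 'M[R]_n -> R) :
  (forall i, polyfun (F i)) -> polyfun (fun M => \sum_(i <- r) F i M).
Proof.
move=> Fp; elim: r => [|i r IHr].
  by apply: polyfun_ext (polyfun_cst 0) => M; rewrite big_nil.
by apply: polyfun_ext (polyfunD (Fp i) IHr) => M; rewrite big_cons.
Qed.

Lemma polyfun_prod I (r : seq I) (F : I -> 'M[R]_n -> R) :
  (forall i, polyfun (F i)) -> polyfun (fun M => \prod_(i <- r) F i M).
Proof.
move=> Fp; elim: r => [|i r IHr].
  by apply: polyfun_ext (polyfun_cst 1) => M; rewrite big_nil.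
by apply: polyfun_ext (polyfunM (Fp i) IHr) => M; rewrite big_cons.
Qed.

Lemma polyfunX F m : polyfun F -> polyfun (fun M => F M ^+ m).
Proof.
move=> Fp; elim: m => [|m IHm].
  by apply: polyfun_ext (polyfun_cst 1) => M; rewrite expr0.
by apply: polyfun_ext (polyfunM Fp IHm) => M; rewrite exprS.
Qed.

End PolynomialFunctions.

Section PolynomialMaps.
Variables (R : comNzRingType) (n : nat).

Definition polymap m q (F : 'M[R]_n -> 'M[R]_(m, q)) : Prop :=
  forall i j, polyfun (fun M => F M i j).

Lemma polymap_id : polymap (fun M => M).
Proof. by move=> i j; exact: polyfun_coord. Qed.

Lemma polymap_cst m q (A : 'M[R]_(m, q)) : polymap (fun=> A).
Proof. by move=> i j; exact: polyfun_cst. Qed.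

Lemma polymapM m q r (F : 'M[R]_n -> 'M[R]_(m, q)) (G : 'M[R]_n -> 'M[R]_(q, r)) :
  polymap F -> polymap G -> polymap (fun M => F M *m G M).
Proof.
move=> Fp Gp i j; under eq_fun do rewrite mxE.
by apply: polyfun_sum => l; apply: polyfunM; [exact: Fp|exact: Gp].
Qed.

Lemma polymap_adj : polymap (fun M => \adj M).
Proof.
move=> i j; under eq_fun do rewrite mxE /cofactor.
apply: polyfunM; first exact: polyfun_cst.
under eq_fun do rewrite /determinant.
apply: polyfun_sum => s; apply: polyfunM; first exact: polyfun_cst.
by apply: polyfun_prod => l; under eq_fun do rewrite !mxE; exact: polyfun_coord.
Qed.

Lemma polyfun_mx_eval (k : fieldType) (S : comAlgType k) m q (p : mpoly.mpoly (q * q) k)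
    (F : 'M[S]_m -> 'M[S]_q) :
  (forall i j, polyfun (fun M => F M i j)) -> polyfun (fun M => mx_eval p (F M)).
Proof.
move=> Fp; rewrite /mx_eval /mpoly.mmap; apply: polyfun_sum => e.
apply: polyfunM; first exact: polyfun_cst.
apply: polyfun_prod => i; apply: polyfunX.
by case/mxvec_indexP: i => a b; under eq_fun do rewrite mxvecE; exact: Fp.
Qed.

End PolynomialMaps.

Section LinearSpan.
Variables (k : fieldType) (T : Type) (t0 : T).

(** A finite list of values of maximal rank does: ranks are bounded by [q], and one more value
    cannot raise a maximal one. *)
Lemma finite_span q (v : T -> 'rV[k]_q) :
  exists s : seq T, forall t, (v t <= \matrix_(i < size s) v (nth t0 s i))%MS.
Proof.
pose S s : 'M[k]_(size s, q) := \matrix_(i < size s) v (nth t0 s i).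
pose P r := `[< exists s, \rank (S s) = r >].
have P0 : exists r, P r by exists (\rank (S [::])); apply/asboolP; exists [::].
have Pq r : P r -> (r <= q)%N by move=> /asboolP[s <-]; exact: rank_leq_col.
have [r /asboolP[s sr] r_max] := ex_maxnP P0 Pq.
exists s => t; have sub : (S s <= S (t :: s))%MS.
  apply/row_subP => i; have := row_sub (lift ord0 i) (S (t :: s)).
  by rewrite !rowK.
have le : (\rank (S (t :: s)) <= \rank (S s))%N.
  by rewrite sr; apply: r_max; apply/asboolP; exists (t :: s).
have := mxrank_leqif_sup sub; rewrite /leqif => -[le' eq'].
have : (S (t :: s) <= S s)%MS by rewrite -eq' eqn_leq le' le.
by apply: submx_trans; have := row_sub ord0 (S (t :: s)); rewrite rowK.
Qed.

End LinearSpan.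

Section ZariskiDensity.
Variables (k : fieldType) (T : Type) (t0 : T) (n : nat) (P : T -> 'M[k]_n).

Definition vanishing : set (mpoly.mpoly (n * n) k) :=
  [set p | forall t, mx_eval p (P t : 'M[k^o]_n) = 0].

Variable R : comAlgType k.

Local Notation in_R := (in_alg R).
Local Notation PR t := (map_mx (in_alg R) (P t)).

(** The equations of the closure have coefficients in [k], those of [F] in [R]. Only the finitely
    many monomials of [F] matter: their values at T span a finite-dimensional [k]-space, and the
    equations over [k] force the monomials at [h] to be an [R]-combination of their values at
    finitely many points of T. Since [F] is linear in its monomials, it vanishes at [h]. *)
Lemma zariski_density (h : 'M[R]_n) (F : 'M[R]_n -> R) :
  (forall p, vanishing p -> mx_eval p h = 0) -> polyfun F ->
  (forall t, F (PR t) = 0) -> F h = 0.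
Proof.
move=> hE [Q FQ] F0; set ms := mpoly.msupp Q; set q := size ms.
pose mon (A : comAlgType k) (M : 'M[A]_n) (j : 'I_q) : A :=
  mpoly.mmap1 (fun i => mxvec M 0 i) (tnth (in_tuple ms) j).
pose v t : 'rV[k]_q := \row_j mon k^o (P t) j.
have [s sP] := finite_span t0 v; set S := (\matrix_i _) in sP.
pose c : 'rV[R]_q := \row_j mon R h j.
(* Each column of the cokernel is the coefficient vector of a polynomial over [k] that vanishes on
   T, hence at [h]. *)
have c_coker : c *m map_mx in_R (cokermx S) = 0.
  apply/rowP => l; rewrite mxE [RHS]mxE.
  pose p : mpoly.mpoly (n * n) k :=
    \sum_j cokermx S j l *: mpoly.mpolyX k (tnth (in_tuple ms) j).
  have pE (A : comAlgType k) (M : 'M[A]_n) :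
      mx_eval p M = \sum_j mon A M j * (cokermx S j l)%:A.
    rewrite /mx_eval /p raddf_sum; apply: eq_bigr => j _ /=.
    by rewrite mpoly.mmapZ mpoly.mmapX mulrC.
  have p0 : vanishing p.
    move=> t; rewrite pE; have /eqP vc : v t *m cokermx S == 0 by rewrite -submxE.
    have := congr1 (fun M : 'rV_q => M 0 l) vc; rewrite [RHS]mxE; apply: etrans.
    rewrite mxE; apply: eq_bigr => j _; rewrite [in RHS](mxE _ _ 0 j); congr (_ * _).
    exact: mulr1.
  apply: etrans (hE _ p0); rewrite pE; apply: eq_bigr => j _.
  by rewrite (mxE _ _ 0 j) mxE.
(* Rank arguments are confined to the field; this identity between matrices over [k] can be
   transported to [R]. *)
have split1 : 1%:M = pinvmx S *m S + cokermx S *m row_ebase S.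
  rewrite -[X in _ *m X + _](mulmx_ebase S) /pinvmx /cokermx !mulmxA.
  rewrite (mulmxKV (col_ebase_unit S)) -(mulmxA (invmx _)) pid_mx_id ?rank_leq_row //.
  by rewrite -mulmxDl -mulmxDr /copid_mx addrC subrK mulmx1 mulVmx ?row_ebase_unit.
pose w := c *m map_mx in_R (pinvmx S).
have cE : c = w *m map_mx in_R S.
  rewrite -[LHS]mulmx1 -(map_mx1 in_R) split1 map_mxD mulmxDr.
  rewrite (map_mxM _ (pinvmx S)) (map_mxM _ (cokermx S)) !mulmxA.
  by rewrite c_coker mul0mx addr0.
have monP t j : mon R (PR t) j = (mon k^o (P t) j)%:A.
  rewrite /mon /mpoly.mmap1 -[RHS]/(in_R _) rmorph_prod; apply: eq_bigr => i _.
  by rewrite rmorphXn -map_mxvec mxE.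
have FE M : F M = \sum_j mpoly.mcoeff (tnth (in_tuple ms) j) Q * mon R M j.
  by rewrite FQ /mx_peval /mpoly.mmap -/ms big_tnth.
rewrite FE.
have cj j : mon R h j = \sum_i w 0 i * mon R (PR (nth t0 s i)) j.
  have := congr1 (fun M : 'rV_q => M 0 j) cE; rewrite !mxE => ->.
  by apply: eq_bigr => i _; rewrite !mxE monP.
under eq_bigr do rewrite cj mulr_sumr.
rewrite exchange_big big1 //= => i _.
under eq_bigr do rewrite mulrCA.
by rewrite -mulr_sumr -FE F0 mulr0.
Qed.

End ZariskiDensity.

(** * Zariski closures of unitriangular representations *)

Section Multiplicative.
Variables (G H : groupType) (f : G -> H) (fM : {morph f : x y / (x * y)%g}).

HB.instance Definition _ := isMultiplicative.Build G H f fM.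

Definition mult_of : {multiplicative G -> H} := f.

End Multiplicative.

Section AlgebraUnit.
Variables (K : fieldType) (R : comAlgType K).

(** [in_alg R] with source the regular algebra, which makes it an arrow of K-algebras along which
    points can be moved. *)
Definition alg_unit : K^o -> R := in_alg R.

Fact alg_unit_zmod : zmod_morphism alg_unit. Proof. exact: (rmorphB (in_alg R)). Qed.
Fact alg_unit_monoid : monoid_morphism alg_unit.
Proof. by split; [exact: (rmorph1 (in_alg R))|exact: (rmorphM (in_alg R))]. Qed.
Fact alg_unit_scalable : scalable alg_unit.
Proof. by move=> a x; rewrite /alg_unit /= scalerA. Qed.
HB.instance Definition _ := GRing.isZmodMorphism.Build K^o R alg_unit alg_unit_zmod.
HB.instance Definition _ := GRing.isMonoidMorphism.Build K^o R alg_unit alg_unit_monoid.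
HB.instance Definition _ := GRing.isScalable.Build K K^o R _ alg_unit alg_unit_scalable.

End AlgebraUnit.

Section LinearImage.
Variables (R : nzRingType) (N n : nat).

(** The linear map of matrix spaces that sends the elementary matrix (i, j) to [C i j]. Given by its
    coefficients, it can be transported along any ring morphism. *)
Definition lin_image (C : 'I_N -> 'I_N -> 'M[R]_n) (M : 'M[R]_N) : 'M[R]_n :=
  \sum_i \sum_j M i j *: C i j.

Lemma lin_imageE C M a b : lin_image C M a b = \sum_i \sum_j M i j * C i j a b.
Proof.
rewrite /lin_image summxE; apply: eq_bigr => i _.
by rewrite summxE; apply: eq_bigr => j _; rewrite mxE.
Qed.

End LinearImage.

Lemma map_lin_image (R S : nzRingType) (f : {rmorphism R -> S}) N n
    (C : 'I_N -> 'I_N -> 'M[R]_n) M :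
  map_mx f (lin_image C M) = lin_image (fun i j => map_mx f (C i j)) (map_mx f M).
Proof.
apply/matrixP => a b; rewrite mxE !lin_imageE rmorph_sum; apply: eq_bigr => i _.
by rewrite rmorph_sum; apply: eq_bigr => j _; rewrite rmorphM !mxE.
Qed.

Lemma lin_image_comp (R : comNzRingType) N m n (C : 'I_m -> 'I_m -> 'M[R]_n)
    (D : 'I_N -> 'I_N -> 'M[R]_m) M :
  lin_image C (lin_image D M) = lin_image (fun i j => lin_image C (D i j)) M.
Proof.
apply/matrixP => a b; rewrite !lin_imageE.
under eq_bigr => i _ do under eq_bigr => j _ do rewrite lin_imageE mulr_suml.
under [RHS]eq_bigr => i _ do under eq_bigr => j _ do rewrite lin_imageE mulr_sumr.
under eq_bigr => i _ do rewrite exchange_big.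
rewrite exchange_big; apply: eq_bigr => u _ /=.
under eq_bigr => i _ do under eq_bigr => j _ do rewrite mulr_suml.
under [RHS]eq_bigr => i _ do under eq_bigr => j _ do rewrite mulr_sumr.
under eq_bigr => i _ do rewrite exchange_big.
rewrite exchange_big; apply: eq_bigr => v _ /=.
by apply: eq_bigr => i _; apply: eq_bigr => j _; rewrite mulrA.
Qed.

Lemma lin_image_linear (R : nzRingType) N n (f : {linear 'M[R]_N -> 'M[R]_n}) M :
  f M = lin_image (fun i j => f (delta_mx i j)) M.
Proof.
rewrite {1}(matrix_sum_delta M) linear_sum; apply: eq_bigr => i _.
by rewrite linear_sum; apply: eq_bigr => j _; rewrite linearZ.
Qed.

Lemma polymap_lin_image (R : comNzRingType) N n (C : 'I_N -> 'I_N -> 'M[R]_n) :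
  polymap (lin_image C).
Proof.
move=> a b; apply: polyfun_ext (fun M => esym (lin_imageE C M a b)) _.
apply: polyfun_sum => i; apply: polyfun_sum => j.
by apply: polyfunM; [exact: polyfun_coord|exact: polyfun_cst].
Qed.

Lemma polymap_comp (R : comNzRingType) n m q (F : 'M[R]_n -> 'M[R]_m)
    (C : 'I_m -> 'I_m -> 'M[R]_q) :
  polymap F -> polymap (fun M => lin_image C (F M)).
Proof.
move=> Fp a b; apply: polyfun_ext (fun M => esym (lin_imageE C (F M) a b)) _.
apply: polyfun_sum => i; apply: polyfun_sum => j.
by apply: polyfunM; [exact: Fp|exact: polyfun_cst].
Qed.

Lemma mx_eval_map (k : fieldType) (R S : comAlgType k) (h : {lrmorphism R -> S}) n
    (p : mpoly.mpoly (n * n) k) (M : 'M[R]_n) :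
  mx_eval p (map_mx h M) = h (mx_eval p M).
Proof.
rewrite /mx_eval /mpoly.mmap rmorph_sum; apply: eq_bigr => m _ /=.
rewrite rmorphM /= rmorph_alg; congr (_ * _).
rewrite /mpoly.mmap1 rmorph_prod; apply: eq_bigr => i _.
by rewrite rmorphXn -map_mxvec mxE.
Qed.

Lemma unitriangular_map (R S : nzRingType) (f : {rmorphism R -> S}) n (M : 'M[R]_n) :
  unitriangular M -> unitriangular (map_mx f M).
Proof. by move=> tM i j ij; rewrite mxE tM // rmorph_nat. Qed.

Lemma unitriangular1 (R : nzRingType) n : unitriangular (1%:M : 'M[R]_n).
Proof. by move=> i j _; rewrite mxE. Qed.

Lemma unitriangularM (R : nzRingType) n (M N : 'M[R]_n) :
  unitriangular M -> unitriangular N -> unitriangular (M *m N).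
Proof.
move=> tM tN i j ij; rewrite mxE (bigD1 i) //= tM // eqxx mul1r tN //.
rewrite big1 ?addr0 // => l li; have [il|il] := leqP i l; last first.
  by rewrite (tM i l (ltnW il)) eq_sym (negbTE li) mul0r.
have jl : (j < l)%N.
  by apply: leq_ltn_trans ij _; rewrite ltn_neqAle il andbT eq_sym.
by rewrite (tN l j (ltnW jl)) -val_eqE /= gtn_eqF // mulr0.
Qed.

Lemma unitriangular_det (R : comNzRingType) n (M : 'M[R]_n) :
  unitriangular M -> \det M = 1.
Proof.
move=> tM; rewrite -det_tr det_trig; last first.
  apply/is_trig_mxP => i j ij; rewrite mxE tM 1?ltnW //.
  by rewrite -val_eqE /= gtn_eqF.
by rewrite big1 // => i _; rewrite mxE tM // eqxx.
Qed.

Lemma unitriangular_mulI (R : comNzRingType) n (M A B : 'M[R]_n) :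
  unitriangular M -> M *m A = M *m B -> A = B.
Proof.
move=> /unitriangular_det dM MAB.
by rewrite -[A]mul1mx -[B]mul1mx -dM -mul_adj_mx -!mulmxA MAB.
Qed.

(** No condition on 1 and on inverses: unitriangular matrices over a commutative ring can be
    cancelled, so multiplicativity implies both. The ring is general because representations over
    the p-adic integers and over Z/p^m occur too. *)
Record urep (k : nzRingType) (T : groupType) := Urep {
  ur_dim : nat;
  ur_map :> T -> 'M[k]_ur_dim;
  ur_tri : forall t, unitriangular (ur_map t);
  ur_mul : forall s t, ur_map (s * t)%g = ur_map s *m ur_map t }.
Arguments ur_tri [k T] u t _ _ _.

Section UnitriangularRepresentations.
Variable T : groupType.

Lemma urep1 (k : comNzRingType) (r : urep k T) : r 1%g = 1%:M.
Proof.
apply: unitriangular_mulI (ur_tri r 1%g) _.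
by rewrite -ur_mul mulg1 mulmx1.
Qed.

Lemma urepV (k : comNzRingType) (r : urep k T) t : r t^-1%g = \adj (r t).
Proof.
apply: unitriangular_mulI (ur_tri r t) _.
by rewrite -ur_mul mulgV urep1 mul_mx_adj (unitriangular_det (ur_tri r t)).
Qed.

Program Definition urep_map (k K : nzRingType) (iota : {rmorphism k -> K})
    (r : urep k T) : urep K T :=
  @Urep K T (ur_dim r) (fun t => map_mx iota (r t)) _ _.
Next Obligation. by move=> k K iota r t; exact: unitriangular_map (ur_tri r t). Qed.
Next Obligation. by move=> k K iota r s t; rewrite /= ur_mul map_mxM. Qed.

Definition ug_urep (k : fieldType) (U : unipGroup k) (phi : {multiplicative T -> U k^o}) :
  urep k T := @Urep k T (ug_dim U) (fun t => val (phi t))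
    (fun t => (ug_ptP (phi t)).1) (fun s t => congr1 val (@gmulfM _ _ phi s t)).

Section ZariskiClosure.
Variables (K : fieldType) (r : urep K T).
Local Notation eqs := (vanishing r).

Fact in_alg_zero_locus (R : comAlgType K) t :
  zero_locus eqs R (map_mx (in_alg R) (r t)).
Proof.
by apply: (@zero_locus_map _ _ _ (alg_unit R)); split=> [|p]; [exact: ur_tri|exact].
Qed.

Lemma closure_density (R : comAlgType K) (h : 'M[R]_(ur_dim r)) (F : 'M[R]_(ur_dim r) -> R) :
  zero_locus eqs R h -> polyfun F ->
  (forall t, F (map_mx (in_alg R) (r t)) = 0) -> F h = 0.
Proof. by move=> [_ hE]; exact: (@zariski_density K T 1%g _ r R h F hE). Qed.

Lemma closure_density_mx (R : comAlgType K) m q (h : 'M[R]_(ur_dim r))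
    (F G : 'M[R]_(ur_dim r) -> 'M[R]_(m, q)) :
  zero_locus eqs R h -> polymap F -> polymap G ->
  (forall t, F (map_mx (in_alg R) (r t)) = G (map_mx (in_alg R) (r t))) -> F h = G h.
Proof.
move=> Zh Fp Gp FG; apply/matrixP => i j; apply/eqP; rewrite -subr_eq0; apply/eqP.
apply: (closure_density (F := fun M => F M i j - G M i j)) => //.
  exact: polyfunB (Fp i j) (Gp i j).
by move=> t; rewrite FG subrr.
Qed.

(** Membership in a zero locus is polynomial, so density applies to each of its equations. The group
    laws on the closure and the homomorphisms out of it all rest on this. *)
Fact closure_image (R : comAlgType K) n (E : set (mpoly.mpoly (n * n) K))
    (F : 'M[R]_(ur_dim r) -> 'M[R]_n) (h : 'M[R]_(ur_dim r)) :
  zero_locus eqs R h -> polymap F ->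
  (forall t, zero_locus E R (F (map_mx (in_alg R) (r t)))) -> zero_locus E R (F h).
Proof.
move=> Zh Fp FE; split=> [i j ij|p Ep].
  apply/eqP; rewrite -subr_eq0; apply/eqP.
  apply: (closure_density (F := fun M => F M i j - (i == j)%:R)) => //.
    exact: polyfunB (Fp i j) (polyfun_cst _ _).
  by move=> t; have [-> //] := FE t; rewrite subrr.
apply: (closure_density (F := fun M => mx_eval p (F M))) => //.
  exact: polyfun_mx_eval.
by move=> t; have [_ ->] := FE t.
Qed.

Fact closure_1 (R : comAlgType K) : zero_locus eqs R 1%:M.
Proof. by rewrite -(map_mx1 (in_alg R)) -(urep1 r); exact: in_alg_zero_locus. Qed.

Fact closure_mul (R : comAlgType K) (M N : 'M[R]_(ur_dim r)) :
  zero_locus eqs R M -> zero_locus eqs R N -> zero_locus eqs R (M *m N).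
Proof.
(* One factor at a time: [N] is replaced by an element of the image of T with [M] fixed, then [M]
   is. *)
move=> ZM ZN; apply: (closure_image (F := mulmx M)) => // [|t].
  by apply: polymapM; [exact: polymap_cst|exact: polymap_id].
apply: (closure_image (F := mulmxr _)) => // [|s].
  by apply: polymapM; [exact: polymap_id|exact: polymap_cst].
by rewrite /= -map_mxM -ur_mul; exact: in_alg_zero_locus.
Qed.

Fact closure_inv (R : comAlgType K) (M : 'M[R]_(ur_dim r)) :
  zero_locus eqs R M -> zero_locus eqs R (\adj M).
Proof.
move=> ZM; apply: (closure_image (F := fun M => \adj M)) => // [|t].
  exact: polymap_adj.
by rewrite -map_mx_adj -urepV; exact: in_alg_zero_locus.
Qed.

Definition zclosure : unipGroup K := UnipGroup closure_1 closure_mul closure_inv.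

Definition closure_pt (t : T) : zclosure K^o := @ug_mk K zclosure K^o _ (in_alg_zero_locus K^o t).

Lemma val_closure_pt t : val (closure_pt t) = r t.
Proof. by apply/matrixP => i j; rewrite mxE [LHS]mulr1. Qed.

Fact closure_ptM : {morph closure_pt : s t / (s * t)%g}.
Proof. by move=> s t; apply: val_inj; rewrite /= ur_mul map_mxM. Qed.

Definition closure_ptm : {multiplicative T -> zclosure K^o} := mult_of closure_ptM.

Section Morphism.
Variables (U : unipGroup K) (phi : {multiplicative T -> U K^o}).
Variable C : 'I_(ur_dim r) -> 'I_(ur_dim r) -> 'M[K]_(ug_dim U).
Hypothesis phiC : forall t, val (phi t) = lin_image C (r t).

Local Notation CR R := (fun i j => map_mx (in_alg R) (C i j)).

Fact closure_hom_subproof (R : comAlgType K) (x : zclosure R) :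
  zero_locus (ug_eqs U) R (lin_image (CR R) (val x)).
Proof.
apply: (closure_image (F := lin_image (CR R)) (ug_ptP x)) => [|t].
  exact: polymap_lin_image.
rewrite -map_lin_image -phiC.
by apply: (@zero_locus_map _ K^o R (alg_unit R)); exact: ug_ptP.
Qed.

Definition closure_hom_app (R : comAlgType K) (x : zclosure R) : U R :=
  ug_mk (closure_hom_subproof x).

(** A linear map need not respect products, but doing so is a polynomial condition in each factor
    separately, and it holds on T because [phi] is a homomorphism. *)
Fact closure_hom_appM (R : comAlgType K) :
  {morph @closure_hom_app R : x y / (x * y)%g}.
Proof.
move=> x y; apply: val_inj; rewrite /=.
apply: (closure_density_mx (h := val y)
  (F := fun M => lin_image (CR R) (val x *m M))
  (G := fun M => lin_image (CR R) (val x) *m lin_image (CR R) M) (ug_ptP y)) => [||t].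
- by apply/polymap_comp/polymapM; [exact: polymap_cst|exact: polymap_id].
- by apply: polymapM; [exact: polymap_cst|exact: polymap_lin_image].
apply: (closure_density_mx (h := val x)
  (F := fun M => lin_image (CR R) (M *m _))
  (G := fun M => lin_image (CR R) M *m lin_image (CR R) _) (ug_ptP x)) => [||s].
- by apply/polymap_comp/polymapM; [exact: polymap_id|exact: polymap_cst].
- by apply: polymapM; [exact: polymap_lin_image|exact: polymap_cst].
by rewrite -map_mxM -ur_mul -!map_lin_image -map_mxM -!phiC gmulfM.
Qed.

Fact closure_hom_natural (R S : comAlgType K) (h : {lrmorphism R -> S}) (x : zclosure R) :
  closure_hom_app (gf_map zclosure h x) = gf_map U h (closure_hom_app x).
Proof.
apply: val_inj; rewrite /= map_lin_image; congr lin_image.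
apply/funext => i; apply/funext => j; apply/matrixP => a b; rewrite !mxE.
by rewrite -[RHS]/(h (C i j a b)%:A) rmorph_alg.
Qed.

Definition closure_hom : gfHom zclosure U :=
  @GfHom _ _ _ (fun R => mult_of (@closure_hom_appM R)) closure_hom_natural.

Lemma val_closure_hom (R : comAlgType K) (x : zclosure R) :
  val (closure_hom R x) = lin_image (CR R) (val x).
Proof. by []. Qed.

Lemma closure_hom_pt t : closure_hom K^o (closure_pt t) = phi t.
Proof.
apply: val_inj; rewrite val_closure_hom val_closure_pt phiC; congr lin_image.
by apply/funext => i; apply/funext => j; apply/matrixP => a b; rewrite mxE [LHS]mulr1.
Qed.

End Morphism.
End ZariskiClosure.
End UnitriangularRepresentations.

(** * Rational forms of unitriangular representations *)

Section RationalForm.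
Variables (k K : fieldType) (iota : {rmorphism k -> K}) (n : nat).
Local Notation V := 'M[K]_n.

(** Coefficients are indexed by [nat], so that they shift along the list; only the first [size s] of
    them count. *)
Definition kspan (s : seq V) (x : V) : Prop :=
  exists c : nat -> k, x = \sum_(i < size s) iota (c i) *: s`_i.

Lemma kspan0 s : kspan s 0.
Proof. by exists (fun=> 0); rewrite big1 // => i _; rewrite rmorph0 scale0r. Qed.

Lemma kspan_comb s a x y : kspan s x -> kspan s y -> kspan s (iota a *: x + y).
Proof.
move=> [c ->] [d ->]; exists (fun i => a * c i + d i).
rewrite scaler_sumr -big_split; apply: eq_bigr => i _ /=.
by rewrite scalerA -rmorphM -scalerDl rmorphD.
Qed.

Lemma kspan_cons b s x :
  kspan (b :: s) x <-> exists a y, kspan s y /\ x = iota a *: b + y.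
Proof.
split=> [[c ->]|[a [_ [[c ->] ->]]]].
  exists (c 0%N), (\sum_(i < size s) iota (c i.+1) *: s`_i); split.
    by exists (fun i => c i.+1).
  by rewrite /= big_ord_recl.
by exists (fun i => if i is j.+1 then c j else a); rewrite /= big_ord_recl.
Qed.

Lemma kspanS b s x : kspan s x -> kspan (b :: s) x.
Proof. by move=> sx; apply/kspan_cons; exists 0, x; rewrite rmorph0 scale0r add0r. Qed.

Lemma kspan_head b s : kspan (b :: s) b.
Proof.
apply/kspan_cons; exists 1, 0; split; first exact: kspan0.
by rewrite rmorph1 scale1r addr0.
Qed.

Lemma kspan_mem s b : b \in s -> kspan s b.
Proof.
elim: s => // a s IHs; rewrite inE => /predU1P[->|/IHs]; first exact: kspan_head.
exact: kspanS.
Qed.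

Lemma kspan_sub s s' : (forall b, b \in s -> kspan s' b) ->
  forall x, kspan s x -> kspan s' x.
Proof.
elim: s => [_ x [c ->]|b s IHs ss' x /kspan_cons[a [y [sy ->]]]].
  by rewrite big_ord0; exact: kspan0.
apply: kspan_comb; first by apply: ss'; rewrite mem_head.
by apply: IHs sy => d ds; apply: ss'; rewrite inE ds orbT.
Qed.

(** Linear independence over [k] in triangular form, matching the recursion of [kflag]. *)
Fixpoint kfree (s : seq V) : Prop :=
  if s is b :: s' then ~ kspan s' b /\ kfree s' else True.

Lemma kfree_coef (s : seq V) (c d : nat -> k) : kfree s ->
  \sum_(i < size s) iota (c i) *: s`_i = \sum_(i < size s) iota (d i) *: s`_i ->
  forall i, (i < size s)%N -> c i = d i.
Proof.
elim: s c d => // b s IHs c d [nb fs]; rewrite /= !big_ord_recl /= => cd.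
have cd0 : c 0%N = d 0%N.
  apply/eqP; apply: contra_notT nb => cd0; rewrite -subr_eq0 in cd0.
  set C := \sum_(i < _) _ in cd; set D := \sum_(i < _) _ in cd.
  have -> : b = iota ((d 0%N - c 0%N)^-1) *: (iota (-1) *: D + C).
    apply: (@scalerI _ _ (iota (d 0%N - c 0%N))).
      by rewrite fmorph_eq0 -opprB oppr_eq0.
    rewrite scalerA -rmorphM mulfV; last by rewrite -opprB oppr_eq0.
    rewrite rmorph1 scale1r rmorphN1 scaleN1r rmorphB scalerBl.
    rewrite -[C](addKr (iota (c 0%N) *: b)) cd addrCA [_ + D]addrC addKr.
    exact: addrC.
  rewrite -[X in kspan _ X]addr0; apply: kspan_comb (kspan0 _).
  by apply: kspan_comb; [exists (fun i => d i.+1)|exists (fun i => c i.+1)].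
rewrite cd0 in cd; move/addrI: cd => cd.
case=> [//|i] /=; rewrite ltnS => il.
exact: (IHs (fun i => c i.+1) (fun i => d i.+1) fs cd).
Qed.

Section Flags.
Variable U : seq V.

(** Right multiplication by the elements of [U] is strictly triangular along the list. [U] will
    consist of the matrices phi(s) - 1 for the generators s and their inverses. *)
Fixpoint kflag (s : seq V) : Prop :=
  if s is b :: s' then (forall u, u \in U -> kspan s' (b *m u)) /\ kflag s' else True.

Lemma kflag_nth s i : kflag s -> (i < size s)%N ->
  forall u, u \in U -> kspan (drop i.+1 s) (s`_i *m u).
Proof.
elim: s i => // b s IHs [|i] [bU fs] /= il u uU; first by rewrite drop0; exact: bU.
exact: IHs.
Qed.

(* Dropping an element that lies in the span of the later ones keeps the flag. *)
Lemma kflag_free s : kflag s ->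
  exists s', [/\ kfree s', kflag s' & forall x, kspan s x -> kspan s' x].
Proof.
elim: s => [_|b s IHs [bU /IHs[s' [fs' ts' ss']]]]; first by exists [::].
have [bs'|nbs'] := pselect (kspan s' b).
  exists s'; split=> // x /kspan_cons[a [y [/ss' sy ->]]].
  exact: kspan_comb.
exists (b :: s'); split=> [//||x /kspan_cons[a [y [/ss' sy ->]]]].
  by split=> // u /bU/ss'.
by apply: kspan_comb; [exact: kspan_head|exact: kspanS].
Qed.

(** The filtration by superdiagonals: degree 0 is upper triangular, degree 1 strictly so, and in
    degree [n] only 0 is left. *)
Definition upper_deg e (M : V) : Prop := forall i j : 'I_n, (j < i + e)%N -> M i j = 0.

Lemma upper_degM e (M u : V) : upper_deg e M -> upper_deg 1 u -> upper_deg e.+1 (M *m u).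
Proof.
move=> Me u1 i j ij; rewrite mxE big1 // => l _.
have [il|li] := ltnP l (i + e); first by rewrite Me ?mul0r.
by rewrite u1 ?mulr0 // addn1 ltnS -ltnS (leq_trans ij) // addnS ltnS.
Qed.

Hypothesis U1 : forall u, u \in U -> upper_deg 1 u.

(** The list [s] is followed by a flag for all the products of its elements with [U]. These have
    higher degree, so the process stops at degree [n]. Here unipotence is what makes the [k]-span
    finite dimensional, although [K] may be infinite over [k]. *)
Lemma kflag_exists d e (s : seq V) : (e + d = n)%N -> (forall x, x \in s -> upper_deg e x) ->
  exists2 s', kflag s' & forall x, x \in s -> kspan s' x.
Proof.
elim: d e s => [|d IHd] e s edn se.
  exists [::] => // x /se xe; have -> : x = 0; last exact: kspan0.
  by apply/matrixP => i j; rewrite xe ?mxE // ltn_addl // -(addn0 e) edn.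
have [|x|s' fs' ss'] := IHd e.+1 [seq x *m u | x <- s, u <- U].
- by rewrite addSnnS.
- by case/allpairsP => -[y u] [/= ys uU ->]; apply: upper_degM; [exact: se|exact: U1].
exists (s ++ s') => [|x xs]; last by apply: kspan_mem; rewrite mem_cat xs.
suff: forall r : seq V, {subset r <= s} -> kflag (r ++ s') by exact.
elim=> //= x r IHr rs; split=> [u uU|]; last first.
  by apply: IHr => y yr; apply: rs; rewrite inE yr orbT.
apply: (@kspan_sub s'); last by apply/ss'/allpairs_f => //; rewrite rs ?mem_head.
by move=> b bs; apply: kspan_mem; rewrite mem_cat bs orbT.
Qed.

End Flags.

Variable T : groupType.

(** [b] is a [k]-basis of a space of matrices over [K] that contains 1 and is stable under right
    multiplication by phi(T). The representation over [k] is the matrix of this action, and phi(t)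
    is recovered as the image of 1 under t. *)
Lemma rational_form_aux (phi : T -> V) (T_fg : finitely_generated T) :
  (forall t, unitriangular (phi t)) -> (forall s t, phi (s * t)%g = phi s *m phi t) ->
  phi 1%g = 1%:M ->
  exists (r : urep k T) (C : 'I_(ur_dim r) -> 'I_(ur_dim r) -> V),
    forall t, phi t = lin_image C (urep_map iota r t).
Proof.
move=> phi_tri phiM phi1; have [S genS] := T_fg.
(* Inverses of generators are included so that the elements t for which both t and its inverse act
   form a subgroup. *)
pose U := [seq phi s - 1%:M | s <- S] ++ [seq phi s^-1%g - 1%:M | s <- S].
have phi_deg t : upper_deg 1 (phi t - 1%:M).
  move=> i j; rewrite addn1 ltnS => ij; rewrite !mxE phi_tri //.
  by rewrite subrr.
have U1 u : u \in U -> upper_deg 1 u.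
  by rewrite mem_cat => /orP[] /mapP[s _ ->]; exact: phi_deg.
have [|s0 flag0 span0] := @kflag_exists U U1 n 0 [:: 1%:M] (add0n _).
  move=> x; rewrite inE => /eqP-> i j; rewrite addn0 mxE -val_eqE /= => ji.
  by rewrite gtn_eqF.
have [b [free_b flag_b span_b]] := kflag_free flag0.
have [c cE] : kspan b 1%:M by apply/span_b/span0; rewrite mem_head.
set N := size b in cE.
pose acts t (A : 'M[k]_N) := unitriangular A /\
  forall i : 'I_N, b`_i *m phi t = \sum_(j < N) iota (A i j) *: b`_j.
have acts_gen t : phi t - 1%:M \in U -> exists A, acts t A.
  move=> tU; have co (i : 'I_N) : exists c : nat -> k, 
      b`_i *m (phi t - 1%:M) = \sum_(j < N | (i < j)%N) iota (c j) *: b`_j.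
    have [d dE] := kflag_nth flag_b (ltn_ord i) tU.
    (* The coefficients [d] refer to the list with its first i+1 terms dropped. *)
    exists (fun j => d (j - i.+1)%N).
    rewrite dE size_drop -/N.
    rewrite -(big_mkord (fun j => (i < j)%N) (fun j => iota (d (j - i.+1)%N) *: b`_j)).
    rewrite (big_cat_nat _ (n := i.+1)) // [X in _ = _ X _]big1_seq /= ?add0r; last first.
      by move=> j; rewrite mem_index_iota ltnS => /andP[ij /andP[_ ji]]; rewrite ltnNge ji in ij.
    rewrite -[X in index_iota X _](add0n i.+1) big_addn big_mkord.
    rewrite [RHS](eq_bigl xpredT) => [|j]; last exact: leq_addl.
    by apply: eq_bigr => j _; rewrite addnK nth_drop addnC.
  pose d i := projT1 (cid (co i)).
  have dE (i : 'I_N) : b`_i *m (phi t - 1%:M) = \sum_(j < N | (i < j)%N) iota (d i j) *: b`_j.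
    exact: projT2 (cid (co i)).
  exists (\matrix_(i, j) if (i < j)%N then d i j else (i == j)%:R); split.
    by move=> i j ji; rewrite mxE ltnNge ji.
  move=> i; rewrite -[phi t](subrK 1%:M) mulmxDr mulmx1 dE.
  rewrite [RHS](bigID (fun j : 'I_N => (i < j)%N)) /=; congr (_ + _).
    by apply: eq_bigr => j ij; rewrite mxE ij.
  rewrite (bigD1 i) ?ltnn //= mxE ltnn eqxx rmorph1 scale1r big1 ?addr0 //.
  move=> j /andP[ij ji]; rewrite mxE (negbTE ij) eq_sym (negbTE ji).
  by rewrite rmorph0 scale0r.
have actsM s t A B : acts s A -> acts t B -> acts (s * t)%g (A *m B).
  move=> [tA sA] [tB tB']; split=> [|i]; first exact: unitriangularM.
  rewrite phiM mulmxA sA mulmx_suml.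
  under eq_bigr do rewrite -scalemxAl tB' scaler_sumr.
  rewrite exchange_big; apply: eq_bigr => j _ /=.
  rewrite mxE rmorph_sum scaler_suml; apply: eq_bigr => l _.
  by rewrite scalerA -rmorphM.
have acts1 : acts 1%g 1%:M.
  split=> [|i]; first exact: unitriangular1.
  rewrite phi1 mulmx1 (bigD1 i) //= mxE eqxx rmorph1 scale1r big1 ?addr0 //.
  by move=> j ji; rewrite mxE eq_sym (negbTE ji) rmorph0 scale0r.
have acts_inj t A B : acts t A -> acts t B -> A = B.
  move=> [_ tA] [_ tB]; apply/matrixP => i j.
  have Hx (M : 'M[k]_N) : \sum_(j < N) iota (M i j) *: b`_j =
      \sum_(j < N) iota (M i (insubd i j)) *: b`_j.
    by apply: eq_bigr => l _; rewrite valKd.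
  have := kfree_coef free_b (c := fun j => A i (insubd i j)) (d := fun j => B i (insubd i j)).
  move=> /(_ _ j (ltn_ord j)); rewrite !valKd; apply.
  by rewrite -!Hx -tA -tB.
have acts_all t : exists A, acts t A.
  pose H := [set t | (exists A, acts t A) /\ exists A, acts t^-1%g A].
  have HT : H = setT.
    apply: genS => [|s sS].
      split=> [|x y [[A xA] [A' xA']] [[B yB] [B' yB']]].
        by rewrite /H /= invg1; split; exists 1%:M.
      split; first by exists (A *m B'); exact: actsM.
      by exists (B *m A'); rewrite invgM invgK; exact: actsM.
    split; apply: acts_gen; rewrite mem_cat; apply/orP.
      by left; exact: (map_f (fun s => phi s - 1%:M)).
    by right; exact: (map_f (fun s => phi s^-1%g - 1%:M)).
  by have [] : H t by rewrite HT.
pose rho t := projT1 (cid (acts_all t)).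
have rhoP t : acts t (rho t) := projT2 (cid (acts_all t)).
have rhoM s t : rho (s * t)%g = rho s *m rho t.
  by apply: acts_inj (rhoP _) _; exact: actsM.
pose r := @Urep k T N rho (fun t => (rhoP t).1) rhoM.
(* With c the coordinates of 1 in [b], phi(t) is the sum of the c_i (b_i phi(t)), and each b_i
   phi(t) expands through row i of [rho t]. *)
exists r, (fun i j => iota (c i) *: b`_j) => t.
rewrite -[LHS]mul1mx cE mulmx_suml; apply: eq_bigr => i _.
rewrite -scalemxAl (rhoP t).2 scaler_sumr; apply: eq_bigr => j _.
by rewrite mxE !scalerA mulrC.
Qed.

End RationalForm.

Lemma rational_form (k K : fieldType) (iota : {rmorphism k -> K}) (T : groupType)
    (T_fg : finitely_generated T) (phi : urep K T) :
  exists (r : urep k T) (C : 'I_(ur_dim r) -> 'I_(ur_dim r) -> 'M[K]_(ur_dim phi)),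
    forall t, phi t = lin_image C (urep_map iota r t).
Proof.
apply: rational_form_aux => // [t|s t|]; [exact: ur_tri|exact: ur_mul|exact: urep1].
Qed.

(** * The pro-algebraic hull of the unitriangular representations *)

Section DirectSum.
Variables (k : nzRingType) (T : groupType) (r s : urep k T).

Fact urep_sum_tri t : unitriangular (block_mx (r t) 0 0 (s t)).
Proof.
move=> i j; case: (split_ordP i) => i' ->; case: (split_ordP j) => j' ->.
- by rewrite block_mxEul => /ur_tri->; rewrite (inj_eq (@lshift_inj _ _)).
- by move=> ji; rewrite block_mxEur mxE eq_lrshift.
- by move=> _; rewrite block_mxEdl mxE eq_rlshift.
- by rewrite block_mxEdr leq_add2l => /ur_tri->; rewrite (inj_eq (@rshift_inj _ _)).
Qed.

Fact urep_sum_mul u t : block_mx (r (u * t)%g) 0 0 (s (u * t)%g) =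
  block_mx (r u) 0 0 (s u) *m block_mx (r t) 0 0 (s t).
Proof. by rewrite mulmx_block !mulmx0 !mul0mx !addr0 !add0r !ur_mul. Qed.

Definition urep_sum : urep k T := Urep urep_sum_tri urep_sum_mul.

Fact urep0_tri (t : T) : unitriangular (1%:M : 'M[k]_0).
Proof. exact: unitriangular1. Qed.
Fact urep0_mul (u t : T) : (1%:M : 'M[k]_0) = 1%:M *m 1%:M.
Proof. by rewrite mulmx1. Qed.
Definition urep0 : urep k T := Urep urep0_tri urep0_mul.

End DirectSum.

Section Domination.
Variables (k : fieldType) (T : groupType).

(** The order of the inverse system: the entries of [r] are combinations of those of [s]. The
    relation is asked on T only; density extends it to the closures. Direct sums give upper
    bounds. *)
Definition urep_le (r s : urep k T) : Prop :=
  exists C : 'I_(ur_dim s) -> 'I_(ur_dim s) -> 'M[k]_(ur_dim r),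
    forall t, r t = lin_image C (s t).

Lemma urep_le_refl r : urep_le r r.
Proof.
exists (fun i j => delta_mx i j) => t.
by rewrite {1}(matrix_sum_delta (r t)).
Qed.

Lemma urep_le_trans r s u : urep_le r s -> urep_le s u -> urep_le r u.
Proof.
move=> [C rC] [D sD]; exists (fun i j => lin_image C (D i j)) => t.
by rewrite rC sD lin_image_comp.
Qed.

Lemma urep_le_mxsub r s (g : 'I_(ur_dim r) -> 'I_(ur_dim s)) :
  (forall t, r t = mxsub g g (s t)) -> urep_le r s.
Proof.
move=> rg; exists (fun i j => mxsub g g (delta_mx i j)) => t.
rewrite rg; exact: (lin_image_linear (mxsub g g)).
Qed.

Lemma urep_le_suml r s : urep_le r (urep_sum r s).
Proof.
apply: (@urep_le_mxsub r (urep_sum r s) (@lshift _ _)) => t.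
by apply/matrixP => i j; rewrite mxE /= block_mxEul.
Qed.

Lemma urep_le_sumr r s : urep_le s (urep_sum r s).
Proof.
apply: (@urep_le_mxsub s (urep_sum r s) (@rshift _ _)) => t.
by apply/matrixP => i j; rewrite mxE /= block_mxEdr.
Qed.

End Domination.

Section Model.
Variables (k K : fieldType) (iota : {rmorphism k -> K}) (T : groupType).
Implicit Types r s u : urep k T.

Local Notation clos r := (zclosure (urep_map iota r)).

(** These coefficients are chosen and not unique. The transition map does not depend on the choice,
    since density determines it by its values on T. *)
Definition le_mx r s (h : urep_le r s) (i j : 'I_(ur_dim s)) : 'M[K]_(ur_dim r) :=
  map_mx iota (projT1 (cid h) i j).

Lemma le_mxP r s (h : urep_le r s) t :
  urep_map iota r t = lin_image (le_mx h) (urep_map iota s t).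
Proof. by rewrite /= {1}(projT2 (cid h) t) map_lin_image. Qed.

Fact clos_tr_subproof r s (h : urep_le r s) t :
  val (closure_ptm (urep_map iota r) t) = lin_image (le_mx h) (urep_map iota s t).
Proof. by rewrite -le_mxP; exact: val_closure_pt. Qed.

Definition clos_tr r s (h : urep_le r s) : gfHom (clos s) (clos r) :=
  @closure_hom T K (urep_map iota s) (clos r) _ (le_mx h) (clos_tr_subproof h).

Lemma val_clos_tr r s (h : urep_le r s) (R : comAlgType K) (x : clos s R) :
  val (clos_tr h R x) =
  lin_image (fun i j => map_mx (in_alg R) (le_mx h i j)) (val x).
Proof. by []. Qed.

(** The chosen coefficients need not be those of the identity map, but the two maps agree on T. *)
Fact clos_tr_id r (h : urep_le r r) (R : comAlgType K) : clos_tr h R =1 id.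
Proof.
move=> x; apply: val_inj; rewrite val_clos_tr.
apply: (closure_density_mx (F := lin_image _) (G := id) (ug_ptP x)) => [||t].
- exact: polymap_lin_image.
- exact: polymap_id.
- by rewrite -(map_lin_image (in_alg _)) -le_mxP.
Qed.

Fact clos_tr_comp r s u (h : urep_le r s) (h' : urep_le s u) (h'' : urep_le r u)
    (R : comAlgType K) : clos_tr h'' R =1 clos_tr h R \o clos_tr h' R.
Proof.
move=> x; apply: val_inj.
rewrite -[RHS]/(val (clos_tr h R (clos_tr h' R x))) !val_clos_tr.
apply: (closure_density_mx (F := lin_image _)
  (G := fun M => lin_image _ (lin_image _ M)) (ug_ptP x)) => [||t].
- exact: polymap_lin_image.
- exact/polymap_comp/polymap_lin_image.
- by rewrite -!(map_lin_image (in_alg R)) -!le_mxP.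
Qed.

Fact urep_directed r s : exists u, urep_le r u /\ urep_le s u.
Proof. by exists (urep_sum r s); split; [exact: urep_le_suml|exact: urep_le_sumr]. Qed.

Definition model : prounipGroup K := @ProunipGroup K (urep k T) (@urep_le k T)
  (@urep_le_refl k T) (@urep_le_trans k T) (inhabits (urep0 k T)) urep_directed
  (fun r => clos r) clos_tr clos_tr_id clos_tr_comp.

Fact model_pt_subproof t : pu_compat (G := model) (fun r => closure_pt (urep_map iota r) t).
Proof.
move=> r s h; apply: val_inj; rewrite val_clos_tr.
by rewrite -(map_lin_image (in_alg _)) -le_mxP.
Qed.

Definition model_pt t : model K^o := pu_mk (model_pt_subproof t).

Definition model_mx (R : comAlgType K) (x : model R) r : 'M[R]_(ur_dim r) :=
  val (val x r).

Lemma model_mx_pt t r : model_mx (model_pt t) r = urep_map iota r t.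
Proof. exact: (val_closure_pt (urep_map iota r) t). Qed.

Lemma model_mx_le r s (h : urep_le r s) (R : comAlgType K) (x : model R) :
  model_mx x r = lin_image (fun i j => map_mx (in_alg R) (le_mx h i j)) (model_mx x s).
Proof. by rewrite /model_mx -(pu_ptP x h). Qed.

Lemma model_eq (R : comAlgType K) (x y : model R) :
  (forall r, model_mx x r = model_mx y r) -> x = y.
Proof. by move=> xy; apply: pu_pt_eq => r; exact/val_inj/xy. Qed.

(** [q] is [p] with a linear form [c l] substituted for each variable, and so serves for all
    algebras at once. *)
Lemma mx_eval_lin_image m n (C : 'I_n -> 'I_n -> 'M[K]_m) (p : mpoly.mpoly (m * m) K) :
  exists q : mpoly.mpoly (n * n) K, forall (R : comAlgType K) (M : 'M[R]_n),
    mx_eval q M = mx_eval p (lin_image (fun i j => map_mx (in_alg R) (C i j)) M).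
Proof.
pose c l := \sum_i \sum_j mxvec (C i j) 0 l *:
  mpoly.mpolyX K (mpoly.mnm1 (mxvec_index i j)).
exists (mpoly.mmap (@mpoly.mpolyC _ K) c p) => R M.
have cE l : mpoly.mmap (in_alg R) (fun i => mxvec M 0 i) (c l) =
    mxvec (lin_image (fun i j => map_mx (in_alg R) (C i j)) M) 0 l.
  case/mxvec_indexP: l => a b; rewrite mxvecE lin_imageE raddf_sum.
  apply: eq_bigr => i _; rewrite raddf_sum; apply: eq_bigr => j _ /=.
  by rewrite mpoly.mmapZ mpoly.mmapX mpoly.mmap1U !mxvecE mxE mulrC.
have -> : mpoly.mmap (@mpoly.mpolyC _ K) c p = \sum_(e <- mpoly.msupp p)
    mpoly.mpolyC _ (mpoly.mcoeff e p) * mpoly.mmap1 c e by [].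
rewrite /mx_eval rmorph_sum [RHS]/mpoly.mmap.
apply: eq_bigr => e _ /=; rewrite rmorphM /= mpoly.mmapC; congr (_ * _).
rewrite /mpoly.mmap1 rmorph_prod; apply: eq_bigr => l _.
by rewrite rmorphXn /= cE.
Qed.

(* The coordinate ring of the model: its elements are determined by their values
   at the points of T. *)
Definition represents (f : T -> K) (r : urep k T) (p : mpoly.mpoly (ur_dim r * ur_dim r) K) :
  Prop := forall t, f t = mx_eval p (urep_map iota r t : 'M[K^o]_(ur_dim r)).

Definition coord_fun (f : T -> K) : Prop := exists r p, @represents f r p.

Lemma represents_le r s (h : urep_le r s) (p : mpoly.mpoly (ur_dim r * ur_dim r) K) :
  exists q : mpoly.mpoly (ur_dim s * ur_dim s) K,
    (forall f, represents f p -> represents f q) /\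
    forall (R : comAlgType K) (x : model R),
      mx_eval q (model_mx x s) = mx_eval p (model_mx x r).
Proof.
have [q qE] := mx_eval_lin_image (le_mx h) p; exists q.
have qx (R : comAlgType K) (x : model R) :
    mx_eval q (model_mx x s) = mx_eval p (model_mx x r).
  by rewrite qE -(model_mx_le h).
split=> [f fp t|//].
by rewrite fp -!(model_mx_pt t) qx.
Qed.

Lemma represents_common f g r s p q :
  @represents f r p -> @represents g s q ->
  exists u p' q', [/\ @represents f u p', @represents g u q' &
    forall (R : comAlgType K) (x : model R),
      mx_eval p' (model_mx x u) = mx_eval p (model_mx x r) /\
      mx_eval q' (model_mx x u) = mx_eval q (model_mx x s)].
Proof.
move=> fp gq; exists (urep_sum r s).
have [p' [fp' xp']] := represents_le (urep_le_suml r s) p.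
have [q' [gq' xq']] := represents_le (urep_le_sumr r s) q.
by exists p', q'; split; [exact: fp'|exact: gq'|].
Qed.

Lemma coord_fun_op (op : K -> K -> K)
    (opP : forall r (p q : mpoly.mpoly (ur_dim r * ur_dim r) K), exists pq,
      forall M : 'M[K^o]_(ur_dim r), mx_eval pq M = op (mx_eval p M) (mx_eval q M)) f g :
  coord_fun f -> coord_fun g -> coord_fun (fun t => op (f t) (g t)).
Proof.
move=> [r [p fp]] [s [q gq]].
have [u [p' [q' [fp' gq' _]]]] := represents_common fp gq.
have [pq pqE] := opP u p' q'; exists u, pq => t.
by rewrite fp' gq' pqE.
Qed.

Lemma coord_fun_cst c : coord_fun (fun=> c).
Proof.
exists (urep0 k T), (mpoly.mpolyC _ c) => t.
by rewrite /mx_eval mpoly.mmapC [RHS]mulr1.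
Qed.

Lemma coord_funD f g : coord_fun f -> coord_fun g -> coord_fun (fun t => f t + g t).
Proof.
apply: (coord_fun_op (op := +%R)) => r p q; exists (p + q) => M.
by rewrite /mx_eval rmorphD.
Qed.

Lemma coord_funM f g : coord_fun f -> coord_fun g -> coord_fun (fun t => f t * g t).
Proof.
apply: (coord_fun_op (op := *%R)) => r p q; exists (p * q) => M.
by rewrite /mx_eval rmorphM.
Qed.

Lemma coord_funN f : coord_fun f -> coord_fun (fun t => - f t).
Proof.
move=> /(coord_funM (coord_fun_cst (-1))); congr coord_fun.
by apply/funext => t; rewrite mulN1r.
Qed.

Definition coord_ring : Type := {f : T -> K | `[< coord_fun f >]}.

HB.instance Definition _ := SubType.on coord_ring.
HB.instance Definition _ := Choice.on coord_ring.

Definition coord_mk f (h : coord_fun f) : coord_ring :=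
  exist (fun f : T -> K => `[< coord_fun f >]) f (asboolT h).

Lemma coordP (a : coord_ring) : coord_fun (val a).
Proof. exact/asboolP/(valP a). Qed.

Lemma coord_eq (a b : coord_ring) : val a =1 val b -> a = b.
Proof. by move=> ab; exact/val_inj/funext. Qed.

Definition coord_cst c := coord_mk (coord_fun_cst c).
Definition coord_add (a b : coord_ring) := coord_mk (coord_funD (coordP a) (coordP b)).
Definition coord_mul (a b : coord_ring) := coord_mk (coord_funM (coordP a) (coordP b)).
Definition coord_opp (a : coord_ring) := coord_mk (coord_funN (coordP a)).

Fact coord_addA : associative coord_add.
Proof. by move=> a b c; apply: coord_eq => t; exact: addrA. Qed.
Fact coord_addC : commutative coord_add.
Proof. by move=> a b; apply: coord_eq => t; exact: addrC. Qed.
Fact coord_add0 : left_id (coord_cst 0) coord_add.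
Proof. by move=> a; apply: coord_eq => t; exact: add0r. Qed.
Fact coord_addN : left_inverse (coord_cst 0) coord_opp coord_add.
Proof. by move=> a; apply: coord_eq => t; exact: addNr. Qed.
HB.instance Definition _ := GRing.isZmodule.Build coord_ring
  coord_addA coord_addC coord_add0 coord_addN.

Fact coord_mulA : associative coord_mul.
Proof. by move=> a b c; apply: coord_eq => t; exact: mulrA. Qed.
Fact coord_mulC : commutative coord_mul.
Proof. by move=> a b; apply: coord_eq => t; exact: mulrC. Qed.
Fact coord_mul1 : left_id (coord_cst 1) coord_mul.
Proof. by move=> a; apply: coord_eq => t; exact: mul1r. Qed.
Fact coord_mulDl : left_distributive coord_mul coord_add.
Proof. by move=> a b c; apply: coord_eq => t; exact: mulrDl. Qed.
Fact coord_1neq0 : coord_cst 1 != 0 :> coord_ring.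
Proof.
apply/eqP => /(congr1 (fun a : coord_ring => val a 1%g)) /eqP.
by rewrite oner_eq0.
Qed.
HB.instance Definition _ := GRing.Zmodule_isComNzRing.Build coord_ring
  coord_mulA coord_mulC coord_mul1 coord_mulDl coord_1neq0.

Definition coord_scale c (a : coord_ring) : coord_ring := coord_cst c * a.
Fact coord_scalerA a b v : coord_scale a (coord_scale b v) = coord_scale (a * b) v.
Proof. by apply: coord_eq => t; exact: mulrA. Qed.
Fact coord_scale1r : left_id 1 coord_scale.
Proof. by move=> a; apply: coord_eq => t; exact: mul1r. Qed.
Fact coord_scalerDr : right_distributive coord_scale +%R.
Proof. by move=> a x y; apply: coord_eq => t; exact: mulrDr. Qed.
Fact coord_scalerDl v : {morph coord_scale^~ v : a b / a + b}.
Proof. by move=> a b; apply: coord_eq => t; exact: mulrDl. Qed.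
HB.instance Definition _ := GRing.Zmodule_isLmodule.Build K coord_ring
  coord_scalerA coord_scale1r coord_scalerDr coord_scalerDl.
Fact coord_scalerAl (a : K) (u v : coord_ring) : a *: (u * v) = (a *: u) * v.
Proof. by apply: coord_eq => t; exact: mulrA. Qed.
HB.instance Definition _ := GRing.Lmodule_isLalgebra.Build K coord_ring coord_scalerAl.
HB.instance Definition _ := GRing.Lalgebra_isComAlgebra.Build K coord_ring.

Section Evaluation.
Variables (R : comAlgType K) (x : model R).

Definition coord_eval (a : coord_ring) : R :=
  let: exist r h := cid (coordP a) in let: exist p _ := cid h in
  mx_eval p (model_mx x r).

(** Independence of the representative chosen in [coord_eval]: two of them, moved to a common
    representation, agree on T and hence on the closure. *)
Lemma coord_evalE (a : coord_ring) r p :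
  @represents (val a) r p -> coord_eval a = mx_eval p (model_mx x r).
Proof.
move=> ap; rewrite /coord_eval; case: cid => s h; case: cid => q aq.
have [u [q' [p' [aq' ap' xE]]]] := represents_common aq ap.
have [<- <-] := xE R x; apply/eqP; rewrite -subr_eq0; apply/eqP.
apply: (closure_density (r := urep_map iota u)
  (F := fun M => mx_eval q' M - mx_eval p' M)).
- exact: (ug_ptP (val x u)).
- by apply: polyfunB; exact: (polyfun_mx_eval _ (@polymap_id _ _)).
move=> t; rewrite !(mx_eval_map (alg_unit R)) -(aq' t) -(ap' t).
exact: subrr.
Qed.

Lemma coord_evalP (a b : coord_ring) : exists r p q,
  [/\ @represents (val a) r p, @represents (val b) r q,
      coord_eval a = mx_eval p (model_mx x r) & coord_eval b = mx_eval q (model_mx x r)].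
Proof.
have [r [p ap]] := coordP a; have [s [q bq]] := coordP b.
have [u [p' [q' [ap' bq' _]]]] := represents_common ap bq.
by exists u, p', q'; split=> //; exact: coord_evalE.
Qed.

Fact coord_eval_zmod : zmod_morphism coord_eval.
Proof.
move=> a b; have [r [p [q [ap bq -> ->]]]] := coord_evalP a b.
rewrite -[RHS](rmorphB (mpoly.mmap _ _)); apply: coord_evalE => t.
by rewrite [RHS](rmorphB (mpoly.mmap _ _)) /= ap bq.
Qed.
Fact coord_eval_monoid : monoid_morphism coord_eval.
Proof.
split=> [|a b].
  rewrite (@coord_evalE _ (urep0 k T) 1) => [|t]; first by rewrite /mx_eval rmorph1.
  by rewrite /mx_eval rmorph1.
have [r [p [q [ap bq -> ->]]]] := coord_evalP a b.
rewrite -[RHS](rmorphM (mpoly.mmap _ _)); apply: coord_evalE => t.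
by rewrite [RHS](rmorphM (mpoly.mmap _ _)) /= ap bq.
Qed.
Fact coord_eval_scalable : scalable coord_eval.
Proof.
move=> c a; have [r [p [_ [ap _ -> _]]]] := coord_evalP a a.
rewrite (@coord_evalE _ r (c *: p)) => [|t]; last first.
  by rewrite /mx_eval mpoly.mmapZ /= [X in _ = X * _]mulr1 ap.
by rewrite /mx_eval mpoly.mmapZ mulr_algl.
Qed.
HB.instance Definition _ := GRing.isZmodMorphism.Build coord_ring R coord_eval
  coord_eval_zmod.
HB.instance Definition _ := GRing.isMonoidMorphism.Build coord_ring R coord_eval
  coord_eval_monoid.
HB.instance Definition _ := GRing.isScalable.Build K coord_ring R _ coord_eval
  coord_eval_scalable.

End Evaluation.

Lemma coord_eval_pt t (a : coord_ring) : coord_eval (model_pt t) a = val a t.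
Proof. by have [r [p ap]] := coordP a; rewrite (coord_evalE _ ap) model_mx_pt -ap. Qed.

Lemma coord_mx_eq m n (A B : 'M[coord_ring]_(m, n)) :
  (forall t, map_mx (coord_eval (model_pt t)) A = map_mx (coord_eval (model_pt t)) B) ->
  A = B.
Proof.
move=> AB; apply/matrixP => i j; apply: coord_eq => t.
by rewrite -!coord_eval_pt; have /matrixP/(_ i j) := AB t; rewrite !mxE.
Qed.

Fact represents_entry r (i j : 'I_(ur_dim r)) :
  represents (fun t => urep_map iota r t i j)
    (mpoly.mpolyX K (mpoly.mnm1 (mxvec_index i j))).
Proof. by move=> t; rewrite /mx_eval mpoly.mmapX mpoly.mmap1U mxvecE. Qed.

Definition coord_mx r : 'M[coord_ring]_(ur_dim r) :=
  \matrix_(i, j) coord_mk (ex_intro _ r (ex_intro _ _ (@represents_entry r i j))).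

Lemma map_coord_mx (R : comAlgType K) (x : model R) r :
  map_mx (coord_eval x) (coord_mx r) = model_mx x r.
Proof.
apply/matrixP => i j; rewrite !mxE.
rewrite (@coord_evalE R x (coord_mk _) r _ (@represents_entry r i j)).
by rewrite /mx_eval mpoly.mmapX mpoly.mmap1U mxvecE.
Qed.

Fact coord_mx_locus r : zero_locus (ug_eqs (clos r)) coord_ring (coord_mx r).
Proof.
split=> [i j ij|p p0].
  apply: coord_eq => t; rewrite -!coord_eval_pt rmorph_nat.
  have := map_coord_mx (model_pt t) r => /matrixP/(_ i j); rewrite mxE => ->.
  by rewrite model_mx_pt; exact: (ur_tri (urep_map iota r)).
apply: coord_eq => t; rewrite -!coord_eval_pt rmorph0 -mx_eval_map map_coord_mx.
by rewrite model_mx_pt p0.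
Qed.

Definition generic_pt_at r : clos r coord_ring :=
  @ug_mk K (clos r) coord_ring _ (coord_mx_locus r).

Fact generic_pt_subproof : pu_compat (G := model) generic_pt_at.
Proof.
move=> r s h; apply: val_inj; rewrite val_clos_tr /=.
apply: coord_mx_eq => t; rewrite map_lin_image !map_coord_mx (model_mx_le h).
congr lin_image; apply/funext => i; apply/funext => j.
by apply/matrixP => a b; rewrite !mxE; exact: (rmorph_alg (coord_eval (model_pt t))).
Qed.

(** The universal point of the model, with values in its own coordinate ring: the entries of each
    representation, viewed as functions on T. *)
Definition generic_pt : model coord_ring := pu_mk generic_pt_subproof.

Lemma generic_ptP (R : comAlgType K) (x : model R) :
  gf_map model (coord_eval x) generic_pt = x.
Proof. by apply: model_eq => r; exact: map_coord_mx. Qed.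

(** By naturality it is enough to compare at the generic point. There the values are matrices of
    functions on T, and evaluation at t turns them into the values at [model_pt t]. *)
Lemma model_hom_uniq (U : unipGroup K) (f g : gfHom model U) :
  (forall t, f _ (model_pt t) = g _ (model_pt t)) -> forall R, f R =1 g R.
Proof.
move=> fg R x; rewrite -(generic_ptP x) !gf_natural; congr (gf_map U _ _).
apply: val_inj; apply: coord_mx_eq => t.
have E (h : gfHom model U) : map_mx (coord_eval (model_pt t)) (val (h _ generic_pt)) =
    val (h _ (model_pt t)) by rewrite -{2}(generic_ptP (model_pt t)) gf_natural.
by rewrite !E fg.
Qed.

End Model.

(** * Homomorphisms of group functors *)

Section Homs.
Variable k : fieldType.
Implicit Types F G H : grpFunctor k.

Section Composition.
Variables (F G H : grpFunctor k) (f : gfHom F G) (g : gfHom G H).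

Fact gf_compM (R : comAlgType k) : {morph g R \o f R : x y / (x * y)%g}.
Proof. by move=> x y; rewrite /= !gmulfM. Qed.

Definition gf_comp_app (R : comAlgType k) : {multiplicative F R -> H R} :=
  mult_of (@gf_compM R).

Fact gf_comp_natural (R S : comAlgType k) (h : {lrmorphism R -> S}) (x : F R) :
  gf_comp_app S (gf_map F h x) = gf_map H h (gf_comp_app R x).
Proof. by rewrite /= !gf_natural. Qed.

Definition gf_comp : gfHom F H := GfHom gf_comp_natural.

End Composition.

Definition gf_id F : gfHom F F :=
  @GfHom k F F (fun R => mult_of (fun x y : F R => erefl (x * y)%g)) (fun R S h x => erefl).

Section Projection.
Variables (P : prounipGroup k) (i : pu_idx P).

Fact pu_projM (R : comAlgType k) : {morph (fun x : P R => val x i) : x y / (x * y)%g}.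
Proof. by []. Qed.

Definition pu_proj : gfHom P (pu_grp P i) :=
  @GfHom k P (pu_grp P i) (fun R => mult_of (@pu_projM R)) (fun R S h x => erefl).

End Projection.

Section Lift.
Variables (F : grpFunctor k) (P : prounipGroup k) (f : forall i, gfHom F (pu_grp P i)).
Hypothesis f_compat : forall i j (h : pu_le i j) R x, pu_tr h R (f j R x) = f i R x.

Definition pu_lift_app (R : comAlgType k) (x : F R) : P R :=
  pu_mk (fun i j (h : pu_le i j) => f_compat h x).

Fact pu_lift_appM (R : comAlgType k) : {morph @pu_lift_app R : x y / (x * y)%g}.
Proof. by move=> x y; apply: pu_pt_eq => i; exact: gmulfM. Qed.

Fact pu_lift_natural (R S : comAlgType k) (h : {lrmorphism R -> S}) (x : F R) :
  pu_lift_app (gf_map F h x) = gf_map P h (pu_lift_app x).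
Proof. by apply: pu_pt_eq => i; exact: gf_natural. Qed.

Definition pu_lift : gfHom F P :=
  @GfHom k F P (fun R => mult_of (@pu_lift_appM R)) pu_lift_natural.

Lemma val_pu_lift (R : comAlgType k) (x : F R) i : val (pu_lift R x) i = f i R x.
Proof. by []. Qed.

End Lift.
End Homs.

(** * Homomorphisms from the model to prounipotent groups *)

Section ModelUniversality.
Variables (k K : fieldType) (iota : {rmorphism k -> K}) (T : groupType).
Hypothesis T_fg : finitely_generated T.

Local Notation M := (model iota T).

(* The homomorphism is linear in matrix entries, which makes it continuous on
   K-points for any ring topology. *)
Lemma model_hom_ex (U : unipGroup K) (phi : {multiplicative T -> U K^o}) :
  exists (f : gfHom M U) (r : urep k T) (C : 'I_(ur_dim r) -> 'I_(ur_dim r) -> 'M[K]_(ug_dim U)),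
    (forall t, f _ (model_pt iota t) = phi t) /\
    forall (R : comAlgType K) (x : M R),
      val (f R x) = lin_image (fun i j => map_mx (in_alg R) (C i j)) (model_mx x r).
Proof.
have [r [C phiC]] := rational_form iota T_fg (ug_urep phi).
pose h := @closure_hom T K (urep_map iota r) U phi C phiC.
exists (gf_comp (pu_proj (P := M) r) h), r, C; split=> [t|//].
exact: (@closure_hom_pt T K (urep_map iota r) U phi C phiC t).
Qed.

Lemma model_hom_uniq_pu (P : prounipGroup K) (f g : gfHom M P) :
  (forall t, f _ (model_pt iota t) = g _ (model_pt iota t)) -> forall R, f R =1 g R.
Proof.
move=> fg R x; apply: pu_pt_eq => i.
apply: (model_hom_uniq (f := gf_comp f (pu_proj i)) (g := gf_comp g (pu_proj i))) => t.
by rewrite /= fg.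
Qed.

(** [F] is a mere group functor, so that base changes, which are not given as inverse systems over
    [K], are covered. *)
Definition model_iso (F : grpFunctor K) (theta : T -> F K^o) : Prop :=
  exists (f : gfHom F M) (g : gfHom M F),
    [/\ forall R : comAlgType K, cancel (f R) (g R),
        forall R : comAlgType K, cancel (g R) (f R) &
        forall t, f _ (theta t) = model_pt iota t].

Fact pu_coordM (P : prounipGroup K) (theta : {multiplicative T -> P K^o}) i :
  {morph (fun t => val (theta t) i) : s t / (s * t)%g}.
Proof. by move=> s t; rewrite gmulfM. Qed.

(** One homomorphism for each coordinate of [P]; uniqueness on T makes them compatible. The linear
    form of each coordinate is kept for the continuity argument on the completions. *)
Lemma model_map_ex (P : prounipGroup K) (theta : {multiplicative T -> P K^o}) :
  exists g : gfHom M P, (forall t, g _ (model_pt iota t) = theta t) /\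
    forall i, exists (r : urep k T) (C : 'I_(ur_dim r) -> 'I_(ur_dim r) -> 'M[K]_(ug_dim (pu_grp P i))),
    forall (R : comAlgType K) (x : M R),
      val (val (g R x) i) = lin_image (fun i j => map_mx (in_alg R) (C i j)) (model_mx x r).
Proof.
pose phi i := mult_of (pu_coordM theta i).
pose g i := projT1 (cid (model_hom_ex (phi i))).
have gP i := projT2 (cid (model_hom_ex (phi i))).
have g_pt i t : g i _ (model_pt iota t) = phi i t by have [r [C []]] := gP i.
have g_compat i j (h : pu_le i j) R x : pu_tr h R (g j R x) = g i R x.
  apply: (model_hom_uniq (f := gf_comp (g j) (pu_tr h)) (g := g i)) => t.
  rewrite g_pt -[LHS]/(pu_tr h _ (g j _ (model_pt iota t))) g_pt.
  exact: (pu_ptP (theta t) h).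
exists (pu_lift g_compat); split=> [t|i].
  by apply: pu_pt_eq => i; rewrite val_pu_lift g_pt.
by have [r [C [_ gE]]] := gP i; exists r, C => R x; rewrite -gE.
Qed.

End ModelUniversality.

Lemma factors_uniquely_eq (k : fieldType) (T : Type) (G U : grpFunctor k)
    (theta : T -> G k^o) (phi : T -> U k^o) (f g : gfHom G U) :
  factors_uniquely theta phi -> (forall t, f _ (theta t) = phi t) ->
  (forall t, g _ (theta t) = phi t) -> forall R, f R =1 g R.
Proof. by move=> [h _ uh] fP gP R x; rewrite (uh f) // (uh g). Qed.

(** * From a universal property to an isomorphism with the model *)

Section CompletionIsModel.
Variables (k K : fieldType) (iota : {rmorphism k -> K}) (T : groupType).
Hypothesis T_fg : finitely_generated T.
Variables (G : prounipGroup K) (X : Type) (theta : X -> G K^o) (pt : T -> X).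
Local Notation M := (model iota T).

(* [ext r] is the extension of the representation r from T to X, for which the
   universal property of G is available. *)
Variable ext : forall r : urep k T, X -> zclosure (urep_map iota r) K^o.
Hypothesis ext_pt : forall r t, ext r (pt t) = closure_pt (urep_map iota r) t.
Hypothesis ext_le : forall r s (h : urep_le r s) x, clos_tr iota h _ (ext s x) = ext r x.
Hypothesis ext_univ : forall r, factors_uniquely theta (ext r).
Hypothesis theta_univ : forall i, factors_uniquely theta (fun x => val (theta x) i).

Fact ext_model_subproof x : pu_compat (G := M) (fun r => ext r x).
Proof. by move=> r s h; exact: ext_le. Qed.

Definition ext_model x : M K^o := pu_mk (ext_model_subproof x).

(** Common to the discrete and the l-adic case. The endomorphism of the model is recognised on T by
    density, whereas that of [G] is recognised by the universal property of [G], which needs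
    agreement on all of [X]. The last premise supplies this, with the linear form of [g] as its
    input. *)
Lemma model_iso_ex (theta_pt : {multiplicative T -> G K^o}) :
  (forall t, theta (pt t) = theta_pt t) ->
  (forall g : gfHom M G, (forall t, g _ (model_pt iota t) = theta_pt t) ->
    (forall i, exists (r : urep k T)
        (C : 'I_(ur_dim r) -> 'I_(ur_dim r) -> 'M[K]_(ug_dim (pu_grp G i))),
      forall (R : comAlgType K) (x : M R), val (val (g R x) i) =
        lin_image (fun i j => map_mx (in_alg R) (C i j)) (model_mx x r)) ->
    forall x, g _ (ext_model x) = theta x) ->
  model_iso iota (theta \o pt).
Proof.
move=> thetaE g_ext.
pose f r := s2val (cid2 (ext_univ r)).
have f_ext r x : f r _ (theta x) = ext r x := s2valP (cid2 (ext_univ r)) x.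
have f_compat r s (h : urep_le r s) R x : clos_tr iota h R (f s R x) = f r R x.
  apply: (factors_uniquely_eq (f := gf_comp (f s) (clos_tr iota h)) (ext_univ r)) => // {R}x.
  by rewrite -[LHS]/(clos_tr iota h _ (f s _ (theta x))) f_ext ext_le.
have [g [g_pt g_lin]] := model_map_ex iota T_fg theta_pt.
pose F : gfHom G M := pu_lift (P := M) f_compat.
have F_ext x : F _ (theta x) = ext_model x.
  by apply: pu_pt_eq => r; rewrite val_pu_lift f_ext.
have F_pt t : F _ (theta_pt t) = model_pt iota t.
  by rewrite -thetaE F_ext; apply: pu_pt_eq => r; exact: ext_pt.
exists F, g; split=> [R x|R x|t].
- apply: pu_pt_eq => i.
  apply: (factors_uniquely_eq (f := gf_comp F (gf_comp g (pu_proj i)))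
    (g := pu_proj i) (theta_univ i)) => // {R}x.
  by rewrite -[LHS]/(val (g _ (F _ (theta x))) i) F_ext g_ext.
- apply: (model_hom_uniq_pu (f := gf_comp g F) (g := gf_id M)) => t.
  by rewrite -[LHS]/(F _ (g _ (model_pt iota t))) g_pt F_pt.
- by rewrite -F_pt -thetaE.
Qed.

End CompletionIsModel.

(** * Base change *)

Section CanonicalIsomorphism.
Variables (k K : fieldType) (iota : {rmorphism k -> K}) (T : groupType).
Local Notation M := (model iota T).
Variables (F : grpFunctor K) (P : prounipGroup K).
Variables (a : T -> F K^o) (b : T -> P K^o) (f : gfHom F M) (f' : gfHom M F).
Variables (p : gfHom P M) (p' : gfHom M P).
Hypotheses (fK : forall R : comAlgType K, cancel (f R) (f' R))
  (f'K : forall R : comAlgType K, cancel (f' R) (f R)) (fa : forall t, f _ (a t) = model_pt iota t).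
Hypotheses (pK : forall R : comAlgType K, cancel (p R) (p' R))
  (p'K : forall R : comAlgType K, cancel (p' R) (p R)) (pb : forall t, p _ (b t) = model_pt iota t).

(** Uniqueness passes through the model: a competitor [g], precomposed with [f'], starts from the
    model and is fixed by its values on T. *)
Lemma canonical_iso_model : canonical_iso a b (gf_comp f p').
Proof.
split=> [R|t|g _ ga R x].
- exists (gf_comp p f' R) => x; rewrite /=.
    by rewrite p'K fK.
  by rewrite f'K pK.
- by rewrite /= fa -pb pK.
rewrite -{1}(fK x).
apply: (model_hom_uniq_pu (f := gf_comp f' g) (g := p')) => t.
by rewrite /= -fa fK ga fa -pb pK.
Qed.

End CanonicalIsomorphism.

Section BaseChange.
Variables (k K : fieldType) (iota : {rmorphism k -> K}).

Section Hom.
Variables (F G : grpFunctor k) (f : gfHom F G).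

Fact bc_hom_natural (R S : comAlgType K) (h : {lrmorphism R -> S})
    (x : base_change iota F R) :
  f (restr iota S) (gf_map (base_change iota F) h x) =
  gf_map (base_change iota G) h (f (restr iota R) x).
Proof. exact: gf_natural. Qed.

Definition bc_hom : gfHom (base_change iota F) (base_change iota G) :=
  @GfHom K (base_change iota F) (base_change iota G)
    (fun R => f (restr iota R)) bc_hom_natural.

Lemma bc_hom_pt (x : F k^o) :
  bc_hom K^o (base_change_pt iota F x) = base_change_pt iota G (f k^o x).
Proof. exact: (gf_natural f (restr_unit iota : {lrmorphism k^o -> restr iota K^o}) x). Qed.

End Hom.

Variable T : groupType.
Local Notation id_k := (idfun : {rmorphism k -> k}).

Lemma restr_alg (R : comAlgType K) n (A : 'M[k]_n) :
  map_mx (in_alg (restr iota R)) (map_mx id_k A) = map_mx (in_alg R) (map_mx iota A).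
Proof. by apply/matrixP => i j; rewrite !mxE. Qed.

(** Over a K-algebra [R], either locus satisfies every polynomial with coefficients in [R] that
    vanishes on T, and these include the equations of the other one. *)
Lemma zclosure_restr (r : urep k T) (R : comAlgType K) (M : 'M[R]_(ur_dim r)) :
  zero_locus (vanishing (urep_map id_k r)) (restr iota R) M <->
  zero_locus (vanishing (urep_map iota r)) R M.
Proof.
split=> ZM; have [tM _] := ZM; split=> [//|p p0].
  have H := @closure_density T k (urep_map id_k r) (restr iota R) M
    (fun N => mx_eval p (N : 'M[R]_(ur_dim r))) ZM.
  apply: H => [|t].
    exact: (polyfun_mx_eval _ (@polymap_id R _)).
  by rewrite restr_alg (mx_eval_map (alg_unit R)) p0 rmorph0.
have H := @closure_density T K (urep_map iota r) R M
  (fun N => mx_eval p (N : 'M[restr iota R]_(ur_dim r))) ZM.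
apply: H => [|t].
  exact: (polyfun_mx_eval _ (@polymap_id (restr iota R) _)).
by rewrite -restr_alg (mx_eval_map (alg_unit (restr iota R))) p0 rmorph0.
Qed.

Local Notation M0 := (base_change iota (model id_k T)).
Local Notation M1 := (model iota T).

Lemma restr_lin_image (r s : urep k T) (h : urep_le r s) (R : comAlgType K) (N : 'M[R]_(ur_dim s)) :
  lin_image (fun i j => map_mx (in_alg (restr iota R)) (le_mx id_k h i j)) N =
  lin_image (fun i j => map_mx (in_alg R) (le_mx iota h i j)) N.
Proof. by congr lin_image; apply/funext => i; apply/funext => j; exact: restr_alg. Qed.

Section Points.
Variable R : comAlgType K.

Fact bc_model_subproof (x : M0 R) : pu_compat (G := M1) (R := R) (fun r =>
  @ug_mk K (zclosure (urep_map iota r)) R _ ((@zclosure_restr r R _).1 (ug_ptP (val x r)))).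
Proof.
move=> r s h; apply: val_inj; rewrite val_clos_tr -restr_lin_image.
exact: (esym (model_mx_le h x)).
Qed.

Definition bc_model_app (x : M0 R) : M1 R := pu_mk (bc_model_subproof x).

Fact model_bc_subproof (x : M1 R) : pu_compat (G := model id_k T) (R := restr iota R)
  (fun r => @ug_mk k (zclosure (urep_map id_k r)) (restr iota R) _
    ((@zclosure_restr r R _).2 (ug_ptP (val x r)))).
Proof.
move=> r s h; apply: val_inj; rewrite val_clos_tr [LHS]restr_lin_image.
exact: (esym (model_mx_le h x)).
Qed.

Definition model_bc_app (x : M1 R) : M0 R := pu_mk (model_bc_subproof x).

Fact bc_model_appM : {morph bc_model_app : x y / (x * y)%g}.
Proof. by move=> x y; apply: pu_pt_eq => r; exact: val_inj. Qed.

Fact model_bc_appM : {morph model_bc_app : x y / (x * y)%g}.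
Proof. by move=> x y; apply: pu_pt_eq => r; exact: val_inj. Qed.

End Points.

Fact bc_model_natural (R S : comAlgType K) (h : {lrmorphism R -> S}) (x : M0 R) :
  bc_model_app (gf_map M0 h x) = gf_map M1 h (bc_model_app x).
Proof. by apply: pu_pt_eq => r; exact: val_inj. Qed.

Fact model_bc_natural (R S : comAlgType K) (h : {lrmorphism R -> S}) (x : M1 R) :
  model_bc_app (gf_map M1 h x) = gf_map M0 h (model_bc_app x).
Proof. by apply: pu_pt_eq => r; exact: val_inj. Qed.

Definition bc_model : gfHom M0 M1 :=
  @GfHom K M0 M1 (fun R => mult_of (@bc_model_appM R)) bc_model_natural.

Definition model_bc : gfHom M1 M0 :=
  @GfHom K M1 M0 (fun R => mult_of (@model_bc_appM R)) model_bc_natural.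

Lemma bc_modelK R : cancel (bc_model R) (model_bc R).
Proof. by move=> x; apply: pu_pt_eq => r; exact: val_inj. Qed.

Lemma model_bcK R : cancel (model_bc R) (bc_model R).
Proof. by move=> x; apply: pu_pt_eq => r; exact: val_inj. Qed.

Lemma bc_model_pt t :
  bc_model _ (base_change_pt iota (model id_k T) (model_pt id_k t)) = model_pt iota t.
Proof.
apply: model_eq => r; apply/matrixP => i j; rewrite model_mx_pt.
transitivity (iota (model_mx (model_pt id_k t) r i j)); first by rewrite [LHS]mxE.
by rewrite model_mx_pt !mxE.
Qed.

Lemma model_iso_base_change (F : grpFunctor k) (theta : T -> F k^o) :
  model_iso id_k theta -> model_iso iota (base_change_pt iota F \o theta).
Proof.
move=> [f [g [fK gK fP]]].
exists (gf_comp (bc_hom f) bc_model), (gf_comp model_bc (bc_hom g)).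
split=> [R x|R x|t].
- transitivity (g (restr iota R) (model_bc R (bc_model R (f (restr iota R) x)))).
    reflexivity.
  by rewrite bc_modelK; exact: fK.
- transitivity (bc_model R (f (restr iota R) (g (restr iota R) (model_bc R x)))).
    reflexivity.
  by rewrite gK; exact: model_bcK.
transitivity (bc_model _ (bc_hom f _ (base_change_pt iota F (theta t)))).
  reflexivity.
transitivity (bc_model _ (base_change_pt iota (model id_k T) (f _ (theta t)))).
  by congr (bc_model _ _); exact: bc_hom_pt.
rewrite fP; exact: bc_model_pt.
Qed.

End BaseChange.

(** The case where [X] is T itself: nothing has to be extended. *)
Lemma model_iso_discrete (k : fieldType) (T : groupType) (T_fg : finitely_generated T)
    (G : prounipGroup k) (theta : {multiplicative T -> G k^o}) :
  is_unip_completion theta -> model_iso (idfun : {rmorphism k -> k}) theta.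
Proof.
move=> uG.
apply: (@model_iso_ex _ _ _ _ T_fg G T theta id
  (fun r => closure_ptm (urep_map (idfun : {rmorphism k -> k}) r)) _ _ _ _ theta) => //.
- by move=> r s h x; exact: (pu_ptP (model_pt _ x) h).
- by move=> i; exact: (uG _ (mult_of (pu_coordM theta i))).
move=> Hyp0 g gP _ x; rewrite -gP; congr (g _ _).
exact: pu_pt_eq.
Qed.

(** * Levels of the completions *)

Section FiniteImages.
Variables (T : groupType) (hT : finGroupType) (f : T -> hT).
Hypothesis fM : forall x y, f (x * y)%g = (f x * f y)%g.
Local Open Scope group_scope.

Definition gker : set T := [set t | f t = 1].
Definition gimage : {set hT} := [set h : hT | `[< exists t, f t = h >]]%SET.

Lemma gfun1 : f 1 = 1.
Proof. by apply: (mulgI (f 1)); rewrite -fM !mulg1. Qed.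

Lemma gfunV x : f x^-1 = (f x)^-1.
Proof. by apply: (mulgI (f x)); rewrite -fM !mulgV gfun1. Qed.

Lemma gimageP h : reflect (exists t, f t = h) (h \in gimage).
Proof. by rewrite finset.in_set; exact: asboolP. Qed.

Lemma mem_gimage t : f t \in gimage.
Proof. by apply/gimageP; exists t. Qed.

Fact gimage_group_set : group_set gimage.
Proof.
apply/group_setP; split=> [|x y]; first by rewrite -gfun1 mem_gimage.
by move=> /gimageP[s <-] /gimageP[t <-]; rewrite -fM mem_gimage.
Qed.

Canonical gimage_group := Group gimage_group_set.

Lemma gker_normal : is_normal gker.
Proof.
split=> [|x y]; last by rewrite /gker /= conjgE !fM gfunV => ->; rewrite mul1g mulVg.
split=> [|x y]; rewrite /gker /=; first exact: gfun1.
by rewrite fM gfunV => -> ->; rewrite mul1g invg1.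
Qed.

Lemma gker_index : has_index gker #|gimage|.
Proof.
pose F (h : hT) : set T := [set t | f t = h].
have cosetE : cosets gker = F @` [set h | h \in gimage].
  apply/seteqP; split=> [_ [g _ <-]|_ [h + <-]].
    exists (f g); first exact: mem_gimage.
    apply/seteqP; split=> [t /= ft|_ [x fx <-]].
      by exists (g^-1 * t); [rewrite /gker /= fM gfunV ft mulVg|rewrite mulVKg].
    by rewrite /F /= fM fx mulg1.
  move=> /gimageP[g <-]; exists g => //.
  apply/seteqP; split=> [_ [x fx <-]|t /= ft].
    by rewrite /F /= fM fx mulg1.
  by exists (g^-1 * t); [rewrite /gker /= fM gfunV ft mulVg|rewrite mulVKg].
have Finj : {in [set h | h \in gimage] &, injective F}.
  move=> h h' /set_mem /gimageP[t th] _ FF.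
  by have : F h t by []; rewrite FF /F /= => <-; rewrite th.
rewrite /has_index cosetE (card_eql (inj_card_eq Finj)).
have -> : [set h | h \in gimage] = enum_val @` [set: 'I_#|gimage|].
  apply/seteqP; split=> [h /= hA|_ [i _ <-]]; last exact: enum_valP.
  by exists (enum_rank_in hA h) => //; exact: enum_rankK_in.
rewrite (card_eql (inj_card_eq (in2W enum_val_inj))) card_eq_sym.
exact: card_II.
Qed.

End FiniteImages.

Section LevelIntersection.
Variable T : groupType.
Local Open Scope group_scope.

(* T acts on the cosets of N through a finite permutation group. *)
Lemma gker_of_level (N : set T) m : is_normal N -> has_index N m ->
  exists f : T -> {perm 'I_m},
    [/\ forall x y, f (x * y) = f x * f y, N = gker f & #|gimage f| = m].
Proof.
move=> nN iN; have [[N1 ND] NJ] := nN.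
have NV x : N x -> N x^-1 by move=> Nx; rewrite -[x^-1]mul1g; exact: ND.
have NM x y : N x -> N y -> N (x * y) by move=> Nx /NV Ny; rewrite -[y]invgK; exact: ND.
have : (`I_m #= cosets N)%card by rewrite card_eq_sym.
rewrite (card_eql card_II) => /card_set_bijP[e [e_cos e_inj e_surj]].
pose cos g : set T := [set g * x | x in N].
have cosP g y : cos g y <-> N (g^-1 * y).
  by split=> [[x Nx <-]|Ny]; [rewrite mulKg|exists (g^-1 * y); rewrite ?mulVKg].
have cosE g h : cos g = cos h <-> N (g^-1 * h).
  split=> [gh|gh].
    by apply/cosP; rewrite gh; apply/cosP; rewrite mulVg.
  apply/seteqP; split=> y /cosP y'; apply/cosP.
    have -> : h^-1 * y = (g^-1 * h)^-1 * (g^-1 * y) by rewrite invgM invgK mulgA mulgK.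
    by apply: NM => //; exact: NV.
  have -> : g^-1 * y = (g^-1 * h) * (h^-1 * y) by rewrite mulgA mulgK.
  exact: NM.
have cos_idx g : exists i : 'I_m, e i = cos g.
  by have [|i _ <-] := e_surj (cos g); [exists g|exists i].
have cos_rep (i : 'I_m) : exists g, e i = cos g.
  by have [//|g _ <-] := e_cos i; exists g.
pose idx g := projT1 (cid (cos_idx g)).
have idxP g : e (idx g) = cos g := projT2 (cid (cos_idx g)).
pose rep i := projT1 (cid (cos_rep i)).
have repP i : e i = cos (rep i) := projT2 (cid (cos_rep i)).
have idx_eq g h : idx g = idx h <-> N (g^-1 * h).
  split=> [gh|/cosE gh]; first by apply/cosE; rewrite -!idxP gh.
  by apply: e_inj; rewrite ?in_setE // !idxP.
have repK i : idx (rep i) = i by apply: e_inj; rewrite ?in_setE // idxP -repP.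
have rep_idx g : N (g^-1 * rep (idx g)) by apply/cosE; rewrite -repP idxP.
(* The inverse turns left translation of cosets into a right action, as the left-to-right product of
   permutations requires. *)
pose act g i := idx (g^-1 * rep i).
have actK g h i : act h (act g i) = act (g * h) i.
  apply/esym/idx_eq; rewrite !invgM !invgK mulgA -(mulgA (rep i)^-1) mulgK.
  have := rep_idx (g^-1 * rep i); by rewrite invgM invgK.
have act_inj g : injective (act g).
  move=> i j; rewrite /act => /idx_eq; rewrite invgM invgK mulgA mulgK => ij.
  by rewrite -(repK i) -(repK j); apply/idx_eq.
pose f g := perm (act_inj g).
have fM x y : f (x * y) = f x * f y.
  by apply/permP => i; rewrite permM !permE actK.
have fN : N = gker f.
  apply/seteqP; split=> t; rewrite /gker /=.
    move=> Nt; apply/permP => i; rewrite permE perm1 -[RHS]repK; apply/idx_eq.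
    by rewrite invgM invgK -mulgA -conjgE; exact: NJ.
  move=> /permP/(_ (idx 1)); rewrite permE perm1 -[RHS]repK => /idx_eq.
  rewrite invgM invgK -mulgA -conjgE => Nt.
  by have := NJ _ (rep (idx 1))^-1 Nt; rewrite conjgK.
exists f; split=> //; apply/card_eq_II.
have := gker_index fM; rewrite -fN /has_index => iN'.
by apply: card_eq_trans iN; rewrite card_eq_sym.
Qed.

Lemma is_normalI (M N : set T) : is_normal M -> is_normal N -> is_normal (M `&` N).
Proof.
move=> [[M1 MD] MJ] [[N1 ND] NJ]; split; last first.
  by move=> x y [Mx Nx]; split; [exact: MJ|exact: NJ].
by split=> // x y [Mx Nx] [My Ny]; split; [exact: MD|exact: ND].
Qed.

(** The intersection is the kernel of the pair of permutation actions, whose image is a subgroup of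
    a product of groups of orders [m] and [n]. *)
Lemma has_indexI (M N : set T) m n : is_normal M -> is_normal N ->
  has_index M m -> has_index N n ->
  exists2 d, has_index (M `&` N) d & (d %| m * n)%N.
Proof.
move=> nM nN /(gker_of_level nM)[f [fM -> fm]] /(gker_of_level nN)[g [gM -> gn]].
pose fg t := (f t, g t).
have fgM x y : fg (x * y) = fg x * fg y by rewrite /fg fM gM.
exists #|gimage fg|; last first.
  have -> : (m * n)%N = (#|gimage f| * #|gimage g|)%N by rewrite fm gn.
  rewrite -cardsX; apply: (@cardSg _ (setX_group (gimage_group fM) (gimage_group gM))
    (gimage_group fgM)).
  by apply/fintype.subsetP => _ /gimageP[t <-]; rewrite finset.in_setX !mem_gimage.
suff -> : gker f `&` gker g = gker fg by exact: gker_index.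
apply/seteqP; split=> t; rewrite /gker /=; first by move=> [ft gt]; rewrite /fg ft gt.
by case.
Qed.

End LevelIntersection.

(** * Density of T in its completions *)

Section CompletionDensity.
Variables (T : groupType) (C : nat -> Prop).
Hypothesis C1 : C 1%N.
Hypothesis C_mul_dvd : forall m n d, C m -> C n -> (d %| m * n)%N -> C d.
Local Open Scope group_scope.

Fact is_normalT : is_normal [set: T].
Proof. by []. Qed.

Fact has_indexT : has_index [set: T] 1.
Proof.
rewrite /has_index; have -> : cosets [set: T] = [set setT]; last exact: card_set1.
apply/seteqP; split=> [_ [g _ <-]|_ ->]; last first.
  exists 1 => //; apply/seteqP; split=> // t _.
  by exists t => //; rewrite mul1g.
apply/seteqP; split=> // t _; exists (g^-1 * t) => //.
by rewrite mulVKg.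
Qed.

Definition levelT : level T C :=
  exist _ setT (conj is_normalT (ex_intro2 _ _ 1%N C1 has_indexT)).

Lemma levelI (M N : level T C) : exists L : level T C, sval L `<=` sval M `&` sval N.
Proof.
case: M N => [M [nM [m Cm iM]]] [N [nN [n Cn iN]]] /=.
have [d iMN dmn] := has_indexI nM nN iM iN.
have nMN := is_normalI nM nN.
by exists (exist _ (M `&` N) (conj nMN (ex_intro2 _ _ d (C_mul_dvd Cm Cn dmn) iMN))).
Qed.

Lemma completion_le (x y : completion T C) (M N : level T C) :
  sval M `<=` sval N -> val y M = val x M -> val y N = val x N.
Proof.
move=> MN xyM; have [g xg] := completion_rep x M.
have [_ /(_ _ _ MN) xMN] := completionP x; have [_ /(_ _ _ MN) yMN] := completionP y.
have gM : lcoset_of M g g by apply/Defs.mem_lcoset; rewrite mulVg; exact: level1.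
have [a xa] := completion_rep x N; have [b yb] := completion_rep y N.
have : val x N g by apply: xMN; rewrite xg.
have : val y N g by apply: yMN; rewrite xyM xg.
rewrite xa yb => /Defs.mem_lcoset bg /Defs.mem_lcoset ag.
have ab : sval N (a^-1 * b).
  have -> : a^-1 * b = (a^-1 * g) * (b^-1 * g)^-1 by rewrite invgM invgK mulgA mulgK.
  by apply: levelM => //; exact: levelV.
apply/seteqP; split=> z /Defs.mem_lcoset z'; apply/Defs.mem_lcoset.
  have -> : a^-1 * z = (a^-1 * b) * (b^-1 * z) by rewrite mulgA mulgK.
  exact: levelM.
have -> : b^-1 * z = (a^-1 * b)^-1 * (a^-1 * z) by rewrite invgM invgK mulgA mulgK.
by apply: levelM => //; exact: levelV.
Qed.

(** As two levels contain a third, the sets containing all points that agree with [x] at some level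
    form a filter. It converges to [x] in every coordinate, hence is finer than the
    neighbourhoods. *)
Lemma completion_basis (x : completion T C) B : nbhs x B ->
  exists N : level T C, forall y, val y N = val x N -> B y.
Proof.
pose F : set_system (completion T C) :=
  [set B | exists N : level T C, forall y, val y N = val x N -> B y].
have FF : Filter F.
  split; first by exists levelT.
    move=> P Q [M MP] [N NQ]; have [L LMN] := levelI M N.
    exists L => y xy; split; [apply: MP|apply: NQ]; apply: completion_le xy.
      by move=> t /LMN[].
    by move=> t /LMN[].
  by move=> P Q PQ [N NP]; exists N => y /NP/PQ.
have cF : @completion_proj T C @ F --> completion_proj x.
  apply/cvg_sup => N U [_ [[A _ <-] xA /filterS]]; apply.
  by exists N => y yx; rewrite /= /completion_proj yx.
rewrite nbhsE => -[O [[A oA <-] xA] sub].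
have : F (@completion_proj T C @^-1` A) by apply: cF; exact: open_nbhs_nbhs.
exact: filterS.
Qed.

Lemma completion_dense (x : completion T C) B : nbhs x B ->
  exists t, B (completion_of C t).
Proof.
move=> /completion_basis[N NB]; have [t xt] := completion_rep x N.
by exists t; apply: NB; rewrite xt.
Qed.

End CompletionDensity.

(** * Continuity of polynomial maps over the p-adic numbers *)

Lemma fraction_denominator (R : idomainType) (a : {fraction R}) :
  exists2 d : R, d != 0 & exists n : R, a * FracField.tofrac d = FracField.tofrac n.
Proof.
elim/quotW: a => r; exists \d_r; first exact: denom_ratioP.
exists \n_r; rewrite -[LHS]/(FracField.mul _ _) !piE; apply/eqmodP.
rewrite /= FracField.equivfE /FracField.mulf.
by rewrite !numden_Ratio ?(oner_eq0, mulf_neq0, denom_ratioP) // !mulr1 mulrC.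
Qed.

Section PadicArithmetic.
Variables (p : nat) (p_prime : prime p).
Local Notation Z := (padic_int p_prime).
Local Notation Q := (padic p_prime).
Local Notation q n := ((p ^ n)%N%:Z).
Implicit Types x y z : Z.

Definition padic_emb : Z -> Q := @FracField.tofrac Z.

Fact padic_emb_zmod : zmod_morphism padic_emb. Proof. exact: (rmorphB (@FracField.tofrac Z)). Qed.
Fact padic_emb_monoid : monoid_morphism padic_emb.
Proof.
by split; [exact: (rmorph1 (@FracField.tofrac Z))|exact: (rmorphM (@FracField.tofrac Z))].
Qed.
HB.instance Definition _ := GRing.isZmodMorphism.Build Z Q padic_emb padic_emb_zmod.
HB.instance Definition _ := GRing.isMonoidMorphism.Build Z Q padic_emb padic_emb_monoid.

Lemma padic_emb_inj : injective padic_emb.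
Proof. by move=> x y /eqP; rewrite /padic_emb tofrac_eq => /eqP. Qed.

Local Notation "z %:F" := (padic_emb z).

Lemma padic_natXE n : (p%:R ^+ n : Z) = padic_cst p_prime (q n).
Proof. by rewrite -natrX padic_natE. Qed.

(** The k-th term of the quotient is the term n+k of [x] divided by p^n: division loses n digits,
    which the shift of index restores. *)
Lemma padic_divX x n : val x n = 0 -> exists z, x = p%:R ^+ n * z.
Proof.
move=> xn; have q0 m : q m != 0 :> int by rewrite eqz_nat -lt0n expn_gt0 prime_gt0.
pose f k := (val x (n + k)%N %/ q n)%Z.
have fE k : val x (n + k)%N = f k * q n.
  apply/esym/divzK; apply/dvdz_mod0P.
  by rewrite padic_shift xn mod0z.
have fP k : (f k.+1 = f k %[mod q k])%Z.
  apply/eqP; rewrite eqz_mod_dvd -(@dvdz_mul2r (q n)) //.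
  rewrite mulrBl -!fE -PoszM -expnD (addnC k) addnS -eqz_mod_dvd.
  by rewrite padicS.
exists (padic_mk p_prime fP); apply: padic_eq => k.
rewrite padic_natXE /= modzMml modzMmr mulrC -fE addnC padic_shift.
by rewrite padic_mod.
Qed.

Lemma padic_val_eq x y n : val x n = val y n -> exists z, y = x + p%:R ^+ n * z.
Proof.
move=> xy; have [|z zE] := @padic_divX (y - x) n.
  by rewrite /= modzDmr -xy subrr mod0z.
by exists z; rewrite -zE addrC subrK.
Qed.

(** A term of positive index is then prime to p, so Bezout inverts it modulo each power of p; the
    inverses are compatible because an inverse is unique. *)
Lemma padic_unit_mod x : val x 1%N != 0 -> exists y, x * y = 1.
Proof.
move=> x1.
have co m : coprimez (val x m.+1) (q m.+1).
  rewrite coprimezE /= coprimeXr // coprime_sym prime_coprime //.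
  apply: contra x1 => dv; have := padic_shift x 1 m; rewrite add1n padic_mod => <-.
  by apply/eqP/dvdz_mod0P; rewrite dvdzE expn1.
have inv m : exists u : int, (u * val x m = 1 %[mod q m])%Z.
  case: m => [|m]; first by exists 0; rewrite !modz1.
  have /coprimezP[[u v] /= uv] := co m.
  by exists u; rewrite -uv addrC modzMDl.
pose u m := projT1 (cid (inv m)).
have uP m : (u m * val x m = 1 %[mod q m])%Z := projT2 (cid (inv m)).
have uc m : (u m.+1 = u m %[mod q m])%Z.
  have h : (u m.+1 * val x m = 1 %[mod q m])%Z.
    by rewrite -modzMmr -(padicS x m) modzMmr; apply: padic_modS; exact: uP.
  transitivity ((u m.+1 * val x m * u m) %% q m)%Z.
    by rewrite -mulrA (mulrC (val x m)) -modzMmr uP modzMmr mulr1.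
  by rewrite -modzMml h modzMml mul1r.
exists (padic_mk p_prime uc); apply: padic_eq => m /=.
by rewrite modzMmr mulrC uP.
Qed.

(** If n+1 is the least index at which [x] is nonzero, then [x] is p^n times a unit. *)
Lemma padic_dvdX x : x != 0 -> exists n y, x * y = p%:R ^+ n.
Proof.
move=> /padic_neq0 ex; case: (ex_minnP ex) => n xn n_min.
case: n xn n_min => [|n] xn n_min; first by rewrite dvd1z in xn.
have xn0 : val x n = 0.
  rewrite -padic_mod; apply/dvdz_mod0P; apply: contraT => /n_min.
  by rewrite ltnn.
have [z xz] := padic_divX xn0.
have [|y zy] := @padic_unit_mod z.
  apply: contra xn => /eqP z1; have [w zw] := padic_divX z1.
  apply/dvdz_mod0P; rewrite padic_mod xz zw expr1 mulrA -exprSr.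
  by rewrite padic_natXE /= modzz mul0r mod0z.
by exists n, y; rewrite xz -mulrA zy mulr1.
Qed.

Lemma padic_embX n : ((p%:R ^+ n : Z)%:F = p%:R ^+ n)%R.
Proof. by rewrite rmorphXn rmorph_nat. Qed.

Lemma padic_p_neq0 n : p%:R ^+ n != 0 :> Q.
Proof.
rewrite expf_neq0 //; have := padic_intr_eq0 p_prime p%:Z.
by rewrite -[p%:Z%:~R]/(p%:R) => ->; rewrite eqz_nat -lt0n prime_gt0.
Qed.

Lemma padic_denominator (a : Q) : exists n z, p%:R ^+ n * a = z%:F.
Proof.
have [d d0 [n adn]] := fraction_denominator a.
have [m [y dy]] := padic_dvdX d0; exists m, (n * y).
have {}adn : a * d%:F = n%:F by exact: adn.
by rewrite -padic_embX -dy !rmorphM /= -adn (mulrC a) mulrAC.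
Qed.

Definition padic_integral_elt (a : Q) : Prop := exists z, a = z%:F.

Lemma padic_integral_le (a : Q) m n : (m <= n)%N ->
  padic_integral_elt (p%:R ^+ m * a) -> padic_integral_elt (p%:R ^+ n * a).
Proof.
move=> /subnKC <- [z az]; exists (p%:R ^+ (n - m) * z).
by rewrite exprD mulrAC az rmorphM /= padic_embX mulrC.
Qed.

Definition padic_close n (a b : Q) : Prop := exists z, b = a + p%:R ^+ n * z%:F.

Lemma padic_close_refl n a : padic_close n a a.
Proof. by exists 0; rewrite rmorph0 mulr0 addr0. Qed.

Lemma padic_close_sym n a b : padic_close n a b -> padic_close n b a.
Proof. by move=> [z ->]; exists (- z); rewrite rmorphN mulrN addrK. Qed.

Lemma padic_close_trans n a b c : padic_close n a b -> padic_close n b c -> padic_close n a c.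
Proof. by move=> [z ->] [w ->]; exists (z + w); rewrite rmorphD mulrDr addrA. Qed.

Lemma padic_close_le m n a b : (m <= n)%N -> padic_close n a b -> padic_close m a b.
Proof.
move=> /subnKC <- [z ->]; exists (p%:R ^+ (n - m) * z).
by rewrite rmorphM /= padic_embX mulrA -exprD.
Qed.

Lemma padic_closeD n a b a' b' :
  padic_close n a a' -> padic_close n b b' -> padic_close n (a + b) (a' + b').
Proof. by move=> [z ->] [w ->]; exists (z + w); rewrite rmorphD mulrDr addrACA. Qed.

Lemma padic_closeM n a b : exists m, forall a' b',
  padic_close m a a' -> padic_close m b b' -> padic_close n (a * b) (a' * b').
Proof.
have [c [a1 a1E]] := padic_denominator a; have [d [b1 b1E]] := padic_denominator b.
(* p^c and p^d clear the denominators of [a] and [b], so that p^n survives in both cross terms. *)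
exists (n + c + d)%N => _ _ [z ->] [w ->].
exists (a1 * (p%:R ^+ d * w) + b1 * (p%:R ^+ c * z) + p%:R ^+ (c + d) * (p%:R ^+ (n + c + d) * z * w)).
rewrite !(rmorphD, rmorphM) /= !padic_embX -a1E -b1E !exprD.
set P := p%:R ^+ n; set A := p%:R ^+ c; set B := p%:R ^+ d.
ring.
Qed.

(** The case n = 0 writes the difference as a p-adic integer, whose residues all vanish by the other
    cases. *)
Lemma padic_close_eq a b : (forall n, padic_close n a b) -> a = b.
Proof.
move=> ab; have [z0 z0E] := ab 0%N; rewrite expr0 mul1r in z0E.
suff z00 : z0 = 0 by rewrite z0E z00 rmorph0 addr0.
apply: padic_eq => n; have [z zE] := ab n.
have -> : z0 = p%:R ^+ n * z.
  apply: padic_emb_inj; rewrite rmorphM /= padic_embX.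
  by apply: (addrI a); rewrite -z0E -zE.
by rewrite padic_natXE /= modzz mul0r !mod0z.
Qed.

Lemma padic_nbhs_close (a : Q) (A : set Q) :
  nbhs a A <-> exists n, forall b, padic_close n a b -> A b.
Proof.
split=> [[n An]|[n An]]; exists n; first by move=> _ [z ->].
by move=> z; apply: An; exists z.
Qed.

Definition mx_close m n e (A B : 'M[Q]_(m, n)) : Prop :=
  forall i j, padic_close e (A i j) (B i j).

Lemma mx_nbhs_close m n (M : 'M[Q]_(m, n)) (A : set 'M[Q]_(m, n)) :
  nbhs M A <-> exists e, forall N, mx_close e M N -> A N.
Proof.
split=> [[P MP PA]|[e eA]]; last first.
  exists (fun i j => [set b | padic_close e (M i j) b]) => [i j|N NM]; last exact: eA.
  by apply/padic_nbhs_close; exists e.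
pose c i j := projT1 (cid ((padic_nbhs_close _ _).1 (MP i j))).
have cP i j : forall b, padic_close (c i j) (M i j) b -> P i j b :=
  projT2 (cid ((padic_nbhs_close _ _).1 (MP i j))).
exists (\max_i \max_j c i j)%N => N MN; apply: PA => i j; apply: cP.
apply: padic_close_le (MN i j).
by rewrite (leq_trans _ (leq_bigmax (F := fun i => \max_j c i j)%N i)) // (leq_bigmax (F := c i)).
Qed.

Lemma polyfun_close n (F : 'M[Q]_n -> Q) (M : 'M[Q]_n) e : polyfun F ->
  exists d, forall N, mx_close d M N -> padic_close e (F M) (F N).
Proof.
pose ok G := forall e, exists d, forall N : 'M[Q]_n, mx_close d M N -> padic_close e (G M : Q) (G N).
have okC c : ok (fun=> c) by move=> e'; exists 0%N => N _; exact: padic_close_refl.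
have okD G H : ok G -> ok H -> ok (fun N => G N + H N).
  move=> oG oH e'; have [d dG] := oG e'; have [d' dH] := oH e'.
  exists (maxn d d') => N MN; apply: padic_closeD; [apply: dG|apply: dH] => i j.
    by apply: padic_close_le (MN i j); exact: leq_maxl.
  by apply: padic_close_le (MN i j); exact: leq_maxr.
have okM G H : ok G -> ok H -> ok (fun N => G N * H N).
  move=> oG oH e'; have [c cP] := padic_closeM e' (G M) (H M).
  have [d dG] := oG c; have [d' dH] := oH c.
  exists (maxn d d') => N MN; apply: cP; [apply: dG|apply: dH] => i j.
    by apply: padic_close_le (MN i j); exact: leq_maxl.
  by apply: padic_close_le (MN i j); exact: leq_maxr.
have ok_coord i j : ok (fun N => N i j) by move=> e'; exists e' => N; exact.
have okX G m : ok G -> ok (fun N => G N ^+ m).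
  move=> oG; elim: m => [|m IHm] e'; first exact: okC.
  have [d dP] := okM _ _ oG IHm e'; exists d => N /dP.
  by rewrite !exprS.
move=> [P FP]; suff : ok F by exact.
have -> : F = mx_peval P by apply/funext.
rewrite /mx_peval /mpoly.mmap.
elim: (mpoly.msupp P : seq _) => [|u s IHs] e'.
  by exists 0%N => N _; rewrite !big_nil; exact: padic_close_refl.
suff ok_u : ok (fun N => mpoly.mcoeff u P * mpoly.mmap1 (fun i => mxvec N 0 i) u).
  by have [d dP] := okD _ _ ok_u IHs e'; exists d => N /dP; rewrite !big_cons.
apply: (okM _ _) => //; rewrite /mpoly.mmap1.
elim: (index_enum _) => [|i r IHr] e''.
  by exists 0%N => N _; rewrite !big_nil; exact: padic_close_refl.
have ok_i : ok (fun N => mxvec N 0 i ^+ u i).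
  apply: okX; case/mxvec_indexP: i => a b; under eq_fun do rewrite mxvecE.
  exact: ok_coord.
by have [d dP] := okM _ _ ok_i IHr e''; exists d => N /dP; rewrite !big_cons.
Qed.

Lemma polymap_close n m q (F : 'M[Q]_n -> 'M[Q]_(m, q)) (M : 'M[Q]_n) e : polymap F ->
  exists d, forall N, mx_close d M N -> mx_close e (F M) (F N).
Proof.
move=> Fp; pose d i j := projT1 (cid (polyfun_close M e (Fp i j))).
have dP i j := projT2 (cid (polyfun_close M e (Fp i j))).
exists (\max_i \max_j d i j)%N => N MN i j; apply: (dP i j) => a b.
apply: padic_close_le (MN a b).
by rewrite (leq_trans _ (leq_bigmax (F := fun i => \max_j d i j)%N i)) // (leq_bigmax (F := d i)).
Qed.

Lemma polymap_continuous (X : topologicalType) n m q (A : X -> 'M[Q]_n)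
    (F : 'M[Q]_n -> 'M[Q]_(m, q)) :
  polymap F -> continuous A -> continuous (F \o A).
Proof.
move=> Fp cA x B /mx_nbhs_close[e eB].
have [d dF] := polymap_close (A x) e Fp.
have : nbhs (A x) [set N | mx_close d (A x) N] by apply/mx_nbhs_close; exists d.
move=> /cA near_x; suff : nbhs x [set y | B (F (A y))] by [].
have near_x' : nbhs x [set y | mx_close d (A x) (A y)] by exact: near_x.
by apply: (@filterS _ (nbhs x) _ _ _ _ near_x') => y Ay; apply: eB; exact: dF.
Qed.

End PadicArithmetic.

(** * Continuous extension to the completions *)

Section FiniteUnitriangular.
Variables (p : nat) (R : finComNzRingType) (T : groupType) (r : urep R T).
Local Notation n := (ur_dim r).

Fact row_action_inj (M : 'M[R]_n) : unitriangular M -> injective (fun v : 'rV[R]_n => v *m M).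
Proof.
move=> /unitriangular_det dM u v uv.
by rewrite -[u]mulmx1 -[v]mulmx1 -dM -mul_mx_adj !mulmxA uv.
Qed.

(** Over a finite ring, unitriangular matrices are treated as permutations of the row vectors, which
    places them in a finite group. *)
Definition row_perm_of (M : 'M[R]_n) (h : unitriangular M) : {perm 'rV[R]_n} :=
  perm (row_action_inj h).

Definition urep_perm (t : T) : {perm 'rV[R]_n} := row_perm_of (ur_tri r t).

Lemma urep_permM s t : urep_perm (s * t)%g = (urep_perm s * urep_perm t)%g.
Proof. by apply/permP => v; rewrite permM !permE ur_mul mulmxA. Qed.

Lemma urep_perm1 t : urep_perm t = 1%g <-> r t = 1%:M.
Proof.
split=> [/permP t1|t1]; last by apply/permP => v; rewrite permE perm1 t1 mulmx1.
by apply/row_matrixP => i; rewrite !rowE mulmx1 -[RHS]perm1 -t1 permE.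
Qed.

Definition ut_perms : {set {perm 'rV[R]_n}} :=
  [set s : {perm 'rV[R]_n} | `[< exists2 M, unitriangular M & forall v, s v = v *m M >]]%SET.

Lemma ut_permsP (s : {perm 'rV[R]_n}) :
  reflect (exists2 M, unitriangular M & forall v, s v = v *m M)
  (s \in ut_perms).
Proof. by rewrite finset.in_set; exact: asboolP. Qed.

Fact ut_perms_group_set : group_set ut_perms.
Proof.
apply/group_setP; split=> [|s t].
  apply/ut_permsP; exists 1%:M => [|v]; first exact: unitriangular1.
  by rewrite perm1 mulmx1.
move=> /ut_permsP[M tM sM] /ut_permsP[N tN sN]; apply/ut_permsP.
exists (M *m N) => [|v]; first exact: unitriangularM.
by rewrite permM sN sM mulmxA.
Qed.

Canonical ut_perms_group := Group ut_perms_group_set.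

Definition ut_ffun (s : {perm 'rV[R]_n}) : {ffun 'I_n * 'I_n -> R} :=
  [ffun ij => s (delta_mx 0 ij.1) 0 ij.2].

Definition ut_entries (ij : 'I_n * 'I_n) : pred R :=
  if (ij.2 <= ij.1)%N then pred1 (ij.1 == ij.2)%:R else predT.

(** Such a permutation is determined by its matrix, whose rows are the images of the basis vectors:
    entries above the diagonal are free, the others prescribed. *)
Lemma card_ut_perms : #|ut_perms| = #|family ut_entries|.
Proof.
have sE (s : {perm 'rV[R]_n}) M : (forall v, s v = v *m M) -> forall i j, ut_ffun s (i, j) = M i j.
  by move=> sM i j; rewrite ffunE sM -rowE mxE.
have inj : {in ut_perms &, injective ut_ffun}.
  move=> s t /ut_permsP[M _ sM] /ut_permsP[N _ tN] st; apply/permP => v.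
  by rewrite sM tN; congr (_ *m _); apply/matrixP => i j; rewrite -(sE s) // st (sE t N).
rewrite -(card_in_imset inj); apply: eq_card => g; apply/imsetP/familyP => [[s]|gF].
  move=> /ut_permsP[M tM sM] -> [i j]; rewrite (sE s M sM) /ut_entries /=.
  by case: leqP => // ji; rewrite inE tM.
have tG : unitriangular (\matrix_(i, j) g (i, j) : 'M[R]_n).
  move=> i j ji; have := gF (i, j); rewrite /ut_entries /= ji mxE.
  by rewrite inE => /eqP.
exists (row_perm_of tG).
  by apply/ut_permsP; eexists; [exact: tG|move=> v; rewrite permE].
apply/ffunP => -[i j]; rewrite (sE _ (\matrix_(i, j) g (i, j))) ?mxE // => v.
by rewrite permE.
Qed.

Lemma pnat_ut_perms : p.-nat #|R| -> p.-nat #|ut_perms|.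
Proof.
move=> pR; rewrite card_ut_perms card_family.
rewrite /image_mem; elim: (enum_mem (mem _)) => //= ij s IHs; rewrite pnatM IHs andbT /ut_entries.
by case: ifP => _; rewrite ?card1.
Qed.

(** Lagrange, inside the unitriangular group, whose order is a power of the order of the ring. *)
Lemma pnat_gimage_urep : p.-nat #|R| -> p.-nat #|gimage urep_perm|.
Proof.
move=> /pnat_ut_perms; apply: pnat_dvd.
apply: (@cardSg _ ut_perms_group (gimage_group urep_permM)).
apply/fintype.subsetP => _ /gimageP[t <-]; apply/ut_permsP.
by exists (r t) => [|v]; [exact: ur_tri|rewrite permE].
Qed.

End FiniteUnitriangular.

(** * Reduction modulo powers of p *)

Section Reduction.
Variables (p : nat) (p_prime : prime p) (m : nat).
Local Notation Z := (padic_int p_prime).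
Local Notation q := (p ^ m.+1)%N.

(** The exponent is m+1 for this reason: ['Z_q] has q elements only when q > 1. *)
Lemma modulus_gt1 : (1 < q)%N.
Proof. by rewrite -(exp1n m.+1) ltn_exp2r // prime_gt1. Qed.

Lemma card_Zmod : #|'Z_q| = q.
Proof. by rewrite card_ord Zp_cast // modulus_gt1. Qed.

Lemma intr_modulus (a : int) : ((a %% q)%Z%:~R : 'Z_q) = a%:~R.
Proof.
rewrite [in RHS](divz_eq a q); move: (a %% q)%Z (a %/ q)%Z => u v.
rewrite intrD intrM.
have -> : (q%:Z%:~R : 'Z_q) = 0 by exact: (pchar_Zp modulus_gt1).
by rewrite mulr0 add0r.
Qed.

Definition padic_red (x : Z) : 'Z_q := (val x m.+1)%:~R.

Fact padic_red_zmod : zmod_morphism padic_red.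
Proof.
by move=> x y; rewrite /padic_red -rmorphB -[RHS]intr_modulus /= modzDmr.
Qed.
Fact padic_red_monoid : monoid_morphism padic_red.
Proof.
split=> [|x y]; first by rewrite /padic_red /= intr_modulus.
by rewrite /padic_red -rmorphM -[RHS]intr_modulus.
Qed.
HB.instance Definition _ := GRing.isZmodMorphism.Build Z 'Z_q padic_red padic_red_zmod.
HB.instance Definition _ := GRing.isMonoidMorphism.Build Z 'Z_q padic_red padic_red_monoid.

Lemma padic_red_eq x y : padic_red x = padic_red y -> val x m.+1 = val y m.+1.
Proof.
have vE (z : Z) : exists2 a : nat, val z m.+1 = a%:Z & (a < q)%N.
  have q0 : q%:Z != 0 by rewrite eqz_nat -lt0n ltnW // modulus_gt1.
  have := modz_ge0 (val z m.+1) q0; have := ltz_pmod (val z m.+1) (d := q%:Z).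
  rewrite padic_mod ltz_nat (ltnW modulus_gt1) => /(_ isT).
  by case: (val z m.+1) => // a aq _; exists a.
rewrite /padic_red; have [a -> aq] := vE x; have [b -> bq] := vE y.
rewrite -![_%:~R]/(_%:R) => /(congr1 val); rewrite /= !val_Zp_nat ?modulus_gt1 //.
by rewrite !modn_small // => ->.
Qed.

End Reduction.

Section IntegralExtension.
Variables (p : nat) (p_prime : prime p) (T : groupType) (C : nat -> Prop).
Hypothesis C_pow : forall e, C (p ^ e)%N.
Local Notation Z := (padic_int p_prime).
Variable r : urep Z T.
Local Notation n := (ur_dim r).

Definition red_perm m := @urep_perm 'Z_(p ^ m.+1) T (urep_map (@padic_red p p_prime m) r).

Lemma red_permM m s t : red_perm m (s * t)%g = (red_perm m s * red_perm m t)%g.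
Proof. exact: urep_permM. Qed.

Fact red_index m : C #|gimage (red_perm m)|.
Proof.
have /p_natP[e ->] // : p.-nat #|gimage (red_perm m)|.
by apply: pnat_gimage_urep; rewrite card_Zmod // pnatX pnat_id.
Qed.

(** The congruence kernel of [r] modulo p^(m+1); its index is a power of p, so it occurs in both
    completions. *)
Definition red_level m : level T C := exist _ (gker (red_perm m))
  (conj (gker_normal (red_permM m))
    (ex_intro2 _ _ _ (red_index m) (gker_index (red_permM m)))).

Lemma red_levelP m t : sval (red_level m) t <->
  map_mx (@padic_red p p_prime m) (r t) = 1%:M.
Proof. exact: urep_perm1. Qed.

Definition mx_val_eq m (A B : 'M[Z]_n) : Prop :=
  forall i j, val (A i j) m = val (B i j) m.

Lemma mx_val_eqS m A B : mx_val_eq m.+1 A B -> mx_val_eq m A B.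
Proof. by move=> AB i j; rewrite padicP AB -padicP. Qed.

Lemma mx_val_eqM m A B A' B' :
  mx_val_eq m A A' -> mx_val_eq m B B' -> mx_val_eq m (A *m B) (A' *m B').
Proof.
move=> AA' BB' i j; rewrite !mxE.
apply: (big_ind2 (fun a b : Z => val a m = val b m)) => // [a b c d ab cd|l _] /=.
  by rewrite ab cd.
by rewrite AA' BB'.
Qed.

Lemma mx_val_eq_eq A B : (forall m, mx_val_eq m A B) -> A = B.
Proof. by move=> AB; apply/matrixP => i j; apply: padic_eq => m; exact: AB. Qed.

Lemma red_level_val m s t : sval (red_level m) (s^-1 * t)%g -> mx_val_eq m.+1 (r s) (r t).
Proof.
move=> /red_levelP st i j; apply: padic_red_eq.
have -> : r t = r s *m r (s^-1 * t)%g by rewrite -ur_mul mulVKg.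
have : map_mx (@padic_red p p_prime m) (r s *m r (s^-1 * t)%g) = map_mx (@padic_red p p_prime m) (r s).
  by rewrite map_mxM st mulmx1.
by move=> /matrixP/(_ i j); rewrite [LHS]mxE [RHS]mxE.
Qed.

Lemma red_level_le m : sval (red_level m.+1) `<=` sval (red_level m).
Proof.
move=> t tm; apply/red_levelP.
have : mx_val_eq m.+1 (r 1%g) (r t).
  by apply/mx_val_eqS/red_level_val; rewrite invg1 mul1g.
rewrite urep1 => t1; rewrite -(map_mx1 (@padic_red p p_prime m)).
by apply/matrixP => i j; rewrite [LHS]mxE [RHS]mxE /padic_red -t1.
Qed.

Section Point.
Variable x : completion T C.

Definition level_rep m : T := projT1 (cid (completion_rep x (red_level m))).

Lemma level_repP m : val x (red_level m) = lcoset_of (red_level m) (level_rep m).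
Proof. exact: projT2 (cid (completion_rep x (red_level m))). Qed.

Lemma level_rep_val m t : val x (red_level m) t -> mx_val_eq m.+1 (r (level_rep m)) (r t).
Proof. by rewrite level_repP => /Defs.mem_lcoset/red_level_val. Qed.

Fact ext_entry_subproof i j m :
  (val (r (level_rep m.+1) i j) m.+1 = val (r (level_rep m) i j) m %[mod (p ^ m)%N])%Z.
Proof.
have : val x (red_level m) (level_rep m.+1).
  have [_ /(_ (red_level m.+1) (red_level m) (@red_level_le m))] := completionP x.
  apply; rewrite level_repP; apply/Defs.mem_lcoset; rewrite mulVg.
  exact: level1.
by move=> /level_rep_val/(_ i j) <-; exact: padicS.
Qed.

(** The residue modulo p^m is read at a representative of [x] for the level [red_level m], which
    fixes it even modulo p^(m+1). *)
Definition ext_mx : 'M[Z]_n :=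
  \matrix_(i, j) padic_mk p_prime (ext_entry_subproof i j).

Lemma ext_mx_val m t : val x (red_level m) t -> mx_val_eq m ext_mx (r t).
Proof.
move=> /level_rep_val/mx_val_eqS rt i j; rewrite -rt mxE /=.
exact: padic_mod.
Qed.

End Point.

Lemma ext_mx_of t : ext_mx (completion_of C t) = r t.
Proof.
apply: mx_val_eq_eq => m; apply: ext_mx_val.
by apply/Defs.mem_lcoset; rewrite mulVg; exact: level1.
Qed.

Lemma ext_mxM x y : ext_mx (x * y)%g = ext_mx x *m ext_mx y.
Proof.
apply: mx_val_eq_eq => m.
have [s xs] := completion_rep x (red_level m).
have [t yt] := completion_rep y (red_level m).
have coset_id g : lcoset_of (red_level m) g g.
  by apply/Defs.mem_lcoset; rewrite mulVg; exact: level1.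
have xys : mx_val_eq m (ext_mx (x * y)%g) (r (s * t)%g).
  by apply: ext_mx_val; rewrite /= xs yt lcoset_mul.
have xs' : mx_val_eq m (ext_mx x) (r s) by apply: ext_mx_val; rewrite xs.
have yt' : mx_val_eq m (ext_mx y) (r t) by apply: ext_mx_val; rewrite yt.
by move=> i j; rewrite xys ur_mul (mx_val_eqM xs' yt').
Qed.

Lemma ext_mx_continuous : continuous (fun x => map_mx (@padic_emb p p_prime) (ext_mx x)).
Proof.
move=> x B /mx_nbhs_close[e eB].
suff : nbhs x [set y | B (map_mx (@padic_emb p p_prime) (ext_mx y))] by [].
apply: filterS (completion_nbhs x (red_level e)) => y yx; apply: eB => i j.
have [t xt] := completion_rep x (red_level e).
have tt : lcoset_of (red_level e) t t.
  by apply/Defs.mem_lcoset; rewrite mulVg; exact: level1.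
have xr : mx_val_eq e (ext_mx x) (r t) by apply: ext_mx_val; rewrite xt.
have yr : mx_val_eq e (ext_mx y) (r t) by apply: ext_mx_val; rewrite yx xt.
have [|z zE] := @padic_val_eq p p_prime (ext_mx x i j) (ext_mx y i j) e.
  by rewrite xr yr.
exists z; rewrite [map_mx _ (ext_mx y) i j]mxE [map_mx _ (ext_mx x) i j]mxE zE.
by rewrite rmorphD rmorphM /= padic_embX.
Qed.

End IntegralExtension.

Section ContinuousExtension.
Variables (p : nat) (p_prime : prime p) (T : groupType) (C : nat -> Prop).
Hypothesis C_pow : forall e, C (p ^ e)%N.
Hypothesis C_mul_dvd : forall m n d, C m -> C n -> (d %| m * n)%N -> C d.
Local Notation Z := (padic_int p_prime).
Local Notation Q := (padic p_prime).
Local Notation emb := (@padic_emb p p_prime).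

Lemma mx_denominator m n (s : seq 'M[Q]_(m, n)) : exists c, forall A, A \in s ->
  forall i j, padic_integral_elt (p%:R ^+ c * A i j).
Proof.
elim: s => [|A s [c cP]]; first by exists 0%N.
pose d i j := projT1 (cid (padic_denominator (A i j))).
have dP i j : padic_integral_elt (p%:R ^+ (d i j) * A i j).
  exact: projT2 (cid (padic_denominator (A i j))).
exists (maxn (\max_i \max_j d i j) c)%N => B; rewrite inE => /predU1P[->|Bs] i j; last first.
  by apply: padic_integral_le (cP B Bs i j); rewrite leq_maxr.
apply: padic_integral_le (dP i j); rewrite leq_max; apply/orP; left.
by rewrite (leq_trans _ (leq_bigmax (F := fun i => \max_j d i j)%N i)) // (leq_bigmax (F := d i)).
Qed.

Lemma diag_pow_inv n (c : nat) :
  diag_mx (\row_(i < n) (p%:R ^+ (c * i) : Q)) *m diag_mx (\row_(i < n) p%:R ^- (c * i)) = 1%:M.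
Proof.
apply/matrixP => i j; rewrite mul_diag_mx !mxE; case: eqP => [->|_].
  by rewrite !mulr1n mulfV ?padic_p_neq0.
by rewrite mulr0n mulr0.
Qed.

(* Conjugation by diag(p^(c i)) multiplies the entry (i, j) by p^(c (j - i)). *)
Lemma conj_integral (r : urep Q T) (T_fg : finitely_generated T) :
  exists c (z : T -> 'M[Z]_(ur_dim r)), forall t, map_mx emb (z t) =
    diag_mx (\row_i p%:R ^- (c * i)) *m r t *m diag_mx (\row_i p%:R ^+ (c * i)).
Proof.
have [S genS] := T_fg.
have [c cP] := mx_denominator ([seq r s | s <- S] ++ [seq r s^-1%g | s <- S]).
exists c.
pose D := diag_mx (\row_(i < ur_dim r) (p%:R ^+ (c * i) : Q)).
pose D' := diag_mx (\row_(i < ur_dim r) (p%:R ^- (c * i) : Q)).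
pose int_mx (A : 'M[Q]_(ur_dim r)) := exists z, map_mx emb z = D' *m A *m D.
have DD' : D *m D' = 1%:M by exact: diag_pow_inv.
have int_mxM A B : int_mx A -> int_mx B -> int_mx (A *m B).
  move=> [a aE] [b bE]; exists (a *m b); rewrite map_mxM aE bE.
  by rewrite !mulmxA -(mulmxA _ D) DD' mulmx1.
have int_gen t : r t \in [seq r s | s <- S] ++ [seq r s^-1%g | s <- S] -> int_mx (r t).
  move=> /cP tP.
  have [z zE] : exists z : 'I_(ur_dim r) -> 'I_(ur_dim r) -> Z,
      forall i j, emb (z i j) = (D' *m r t *m D) i j.
    have ex i j : exists z, emb z = (D' *m r t *m D) i j.
      rewrite mul_mx_diag mul_diag_mx !mxE.
      have [ji|ij] := leqP j i.
        exists (i == j)%:R; rewrite (ur_tri r t) // rmorph_nat.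
        have [->|_] := eqVneq i j; last by rewrite mulr0 mul0r.
        by rewrite mulr1 mulVf ?padic_p_neq0.
      (* Above the diagonal j - i is at least 1, so p^(c (j - i)) absorbs the common denominator p^c
         of the generators. Other entries are 0 or 1. *)
      have [|z zE] := @padic_integral_le p p_prime (r t i j) c (c * (j - i)) _ (tP i j).
        by rewrite leq_pmulr // subn_gt0.
      exists z; rewrite -zE mulrAC; congr (_ * _).
      have p0 : (p%:R == 0 :> Q) = false.
        by apply/negbTE; have := padic_p_neq0 p_prime 1; rewrite expr1.
      by rewrite mulnBr expfB_cond ?p0 ?add0n ?leq_mul2l ?(ltnW ij) ?orbT // mulrC.
    exists (fun i j => projT1 (cid (ex i j))) => i j.
    exact: projT2 (cid (ex i j)).
  by exists (\matrix_(i, j) z i j); apply/matrixP => i j; rewrite -zE !mxE.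
have int_all t : int_mx (r t).
  pose H := [set t | int_mx (r t) /\ int_mx (r t^-1%g)].
  have HT : H = setT.
    apply: genS => [|s sS].
      have int1 : int_mx (r 1%g).
        by exists 1%:M; rewrite urep1 mulmx1 (mulmx1C DD') map_mx1.
      split=> [|x y [xA xA'] [yB yB']]; first by rewrite /H /= invg1.
      by split; rewrite ?invgM ?invgK ur_mul; exact: int_mxM.
    split; apply: int_gen; rewrite mem_cat; apply/orP.
      by left; exact: (map_f r).
    by right; exact: (map_f (fun s => r s^-1%g)).
  by have [] : H t by rewrite HT.
exists (fun t => projT1 (cid (int_all t))) => t.
exact: projT2 (cid (int_all t)).
Qed.

(** The integral conjugate is extended and conjugated back; conjugation by a fixed matrix is
    polynomial, hence continuous. *)
Lemma continuous_extension (r : urep Q T) : finitely_generated T ->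
  exists e : completion T C -> 'M[Q]_(ur_dim r), [/\ continuous e,
    forall t, e (completion_of C t) = r t & forall x y, e (x * y)%g = e x *m e y].
Proof.
move=> T_fg; have [c [z zE]] := conj_integral r T_fg.
set D' := diag_mx _ in zE; set D := diag_mx _ in zE.
have DD' : D *m D' = 1%:M by exact: diag_pow_inv.
have emb_inj m n (A B : 'M[Z]_(m, n)) : map_mx emb A = map_mx emb B -> A = B.
  move=> /matrixP AB; apply/matrixP => i j; apply: padic_emb_inj.
  by have := AB i j; rewrite !mxE.
have z_tri t : unitriangular (z t).
  move=> i j ij; apply: padic_emb_inj; rewrite rmorph_nat.
  have := congr1 (fun A : 'M_(ur_dim r) => A i j) (zE t); rewrite mxE => ->.
  rewrite mul_mx_diag mul_diag_mx !mxE (ur_tri r t) //.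
  have [->|_] := eqVneq i j; last by rewrite mulr0 mul0r.
  by rewrite mulr1 mulVf ?padic_p_neq0.
have zM s t : z (s * t)%g = z s *m z t.
  apply: emb_inj; rewrite map_mxM !zE ur_mul !mulmxA.
  by rewrite -(mulmxA _ D) DD' mulmx1.
pose zr : urep Z T := Urep z_tri zM.
pose e (x : completion T C) : 'M[Q]_(ur_dim r) := D *m map_mx emb (ext_mx C_pow zr x) *m D'.
exists e; split=> [|t|x y].
- apply: (@polymap_continuous p p_prime (completion T C) (ur_dim r) _ _
    (fun x => map_mx emb (ext_mx C_pow zr x)) (fun M => D *m M *m D')).
    apply: polymapM; last exact: polymap_cst.
    by apply: polymapM; [exact: polymap_cst|exact: polymap_id].
  move=> x B xB; exact: (@ext_mx_continuous p p_prime T C C_pow zr x B xB).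
- rewrite /e ext_mx_of zE !mulmxA DD' mul1mx -mulmxA.
  by rewrite DD' mulmx1.
- rewrite /e ext_mxM map_mxM !mulmxA -(mulmxA _ D' D).
  by rewrite (mulmx1C DD') mulmx1.
Qed.

(** Near any [x] lies an element of T at which both maps are p^d-close to their values at [x], for
    every d. *)
Lemma continuous_eq m n (e f : completion T C -> 'M[Q]_(m, n)) :
  continuous e -> continuous f ->
  (forall t, e (completion_of C t) = f (completion_of C t)) -> forall x, e x = f x.
Proof.
move=> ce cf ef x; apply/matrixP => i j; apply: padic_close_eq => d.
have near g : continuous g -> nbhs x [set y | @mx_close p p_prime m n d (g x) (g y)].
  move=> cg; apply: (cg x [set N | mx_close d (g x) N]).
  by apply/mx_nbhs_close; exists d.
have C1 : C 1%N by exact: (C_pow 0).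
have [t [/= et ft]] := completion_dense C1 C_mul_dvd (filterI (near e ce) (near f cf)).
apply: padic_close_trans (et i j) _; rewrite ef.
exact/padic_close_sym/ft.
Qed.

Lemma polyfun_ext0 n (e : completion T C -> 'M[Q]_n) (F : 'M[Q]_n -> Q) :
  continuous e -> polyfun F -> (forall t, F (e (completion_of C t)) = 0) ->
  forall x, F (e x) = 0.
Proof.
move=> ce Fp F0 x; apply: padic_close_eq => d.
have [c cP] := polyfun_close (e x) d Fp.
have near : nbhs x [set y | mx_close c (e x) (e y)].
  apply: (ce x [set N | mx_close c (e x) N]).
  by apply/mx_nbhs_close; exists c.
have [t /= et] := completion_dense (C_pow 0) C_mul_dvd near.
by have := cP _ et; rewrite F0.
Qed.

End ContinuousExtension.

(** * The l-adic unipotent completions and the model *)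

Section LadicCompletion.
Variables (k : fieldType) (l : nat) (l_prime : prime l).
Local Notation Q := (padic l_prime).
Variables (iota : {rmorphism k -> Q}) (T : groupType) (C : nat -> Prop).
Hypothesis T_fg : finitely_generated T.
Hypothesis C_pow : forall e, C (l ^ e)%N.
Hypothesis C_mul_dvd : forall m n d, C m -> C n -> (d %| m * n)%N -> C d.

Lemma ug_ladic_continuous (X : topologicalType) (U : unipGroup Q) (f : X -> U Q^o) :
  continuous (fun x => val (f x) : 'M[Q]_(ug_dim U)) -> continuous (f : X -> ug_ladic U).
Proof.
move=> cf; apply/continuousP => _ [A oA <-].
by move/continuousP: cf => /(_ A oA).
Qed.

Lemma pu_ladic_coord_continuous (X : topologicalType) (G : prounipGroup Q) (f : X -> G Q^o) i :
  continuous (f : X -> pu_ladic G) ->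
  continuous (fun x => val (val (f x) i) : 'M[Q]_(ug_dim (pu_grp G i))).
Proof.
move=> cf x.
have c1 : continuous (fun x : ug_ladic (pu_grp G i) => val (x : pu_grp G i Q^o) : 'M[Q]__).
  exact: initial_continuous.
have c2 : continuous (fun y : prod_topology (fun i => ug_ladic (pu_grp G i)) => y i).
  move=> y B yB; have /cvg_sup/(_ i) cN : nbhs y --> y by [].
  by apply: cN; exact: (@initial_continuous _ _ (fun z : prod_topology (fun i => ug_ladic (pu_grp G i)) => z i) y B yB).
have c3 : continuous (fun x : pu_ladic G =>
    (fun i => val (x : G Q^o) i) : prod_topology (fun i => ug_ladic (pu_grp G i))).
  exact: initial_continuous.
move=> B xB; have n1 := c1 (val (f x) i) B xB.
have n2 := c2 (fun i => val (f x) i) _ n1.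
by have n3 := c3 (f x) _ n2; exact: (cf x _ n3).
Qed.

Section Extension.
Variable r : urep k T.
Local Notation R := (urep_map iota r).

Definition ext_fun : completion T C -> 'M[Q]_(ur_dim R) :=
  projT1 (cid (continuous_extension C_pow R T_fg)).

Lemma ext_fun_continuous : continuous ext_fun.
Proof. by have [] := projT2 (cid (continuous_extension C_pow R T_fg)). Qed.

Lemma ext_fun_of t : ext_fun (completion_of C t) = R t.
Proof. by have [_ h _] := projT2 (cid (continuous_extension C_pow R T_fg)); exact: h. Qed.

Lemma ext_funM x y : ext_fun (x * y)%g = ext_fun x *m ext_fun y.
Proof. by have [_ _ h] := projT2 (cid (continuous_extension C_pow R T_fg)); exact: h. Qed.

(** The equations of the Zariski closure are continuous conditions along [ext_fun] and hold on the
    dense image of T. *)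
Fact ext_fun_locus x : zero_locus (ug_eqs (zclosure R)) Q^o (ext_fun x).
Proof.
split=> [i j ij|p p0].
  apply/eqP; rewrite -subr_eq0; apply/eqP.
  apply: (polyfun_ext0 C_pow C_mul_dvd (F := fun M => M i j - (i == j)%:R) ext_fun_continuous).
    by apply: polyfunB; [exact: polyfun_coord|exact: polyfun_cst].
  by move=> t; rewrite ext_fun_of (ur_tri R t) // subrr.
apply: (polyfun_ext0 C_pow C_mul_dvd (F := fun M : 'M[Q]__ => mx_eval p (M : 'M[Q^o]__)) ext_fun_continuous).
  exact: (polyfun_mx_eval _ (@polymap_id Q^o _)).
by move=> t; rewrite ext_fun_of; exact: p0.
Qed.

Definition ext_pt (x : completion T C) : zclosure R Q^o :=
  @ug_mk Q (zclosure R) Q^o _ (ext_fun_locus x).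

Fact ext_ptM : {morph ext_pt : x y / (x * y)%g}.
Proof. by move=> x y; apply: val_inj; exact: ext_funM. Qed.

Definition ext_ptm : {multiplicative completion T C -> zclosure R Q^o} := mult_of ext_ptM.

End Extension.

Lemma lin_image_regular N n (D : 'I_N -> 'I_N -> 'M[Q]_n) (M : 'M[Q]_N) :
  lin_image (fun i j => map_mx (in_alg Q^o) (D i j)) M = lin_image D M.
Proof.
congr lin_image; apply/funext => i; apply/funext => j; apply/matrixP => a b.
by rewrite mxE [LHS]mulr1.
Qed.

Lemma lin_image_continuous (X : topologicalType) N n (D : 'I_N -> 'I_N -> 'M[Q]_n)
    (A : X -> 'M[Q]_N) :
  continuous A -> continuous (fun x => lin_image D (A x)).
Proof. by move=> cA; apply: polymap_continuous cA; exact: polymap_lin_image. Qed.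

Lemma model_iso_ladic (G : prounipGroup Q)
    (theta : {multiplicative completion T C -> G Q^o}) :
  is_ladic_unip_completion theta -> model_iso iota (theta \o completion_of C).
Proof.
move=> [theta_cont uG].
have thetaM : {morph theta \o completion_of C : s t / (s * t)%g}.
  by move=> s t; rewrite /= completion_ofM gmulfM.
have theta_i i : continuous (fun x => val (val (theta x) i) : 'M[Q]_(ug_dim (pu_grp G i))).
  exact: pu_ladic_coord_continuous.
apply: (@model_iso_ex _ _ iota _ T_fg G _ theta (completion_of C)
  (fun r => ext_ptm r) _ _ _ _ (mult_of thetaM)) => //.
- by move=> r t; apply: val_inj; rewrite val_closure_pt; exact: ext_fun_of.
- move=> r s h x; apply: val_inj.
  rewrite val_clos_tr [LHS]lin_image_regular.
  apply: (continuous_eq C_pow C_mul_dvd (e := fun x => lin_image _ (ext_fun s x)) (f := ext_fun r)).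
  + exact/lin_image_continuous/ext_fun_continuous.
  + exact: ext_fun_continuous.
  + by move=> t; rewrite !ext_fun_of; exact: (esym (le_mxP iota h t)).
- by move=> r; apply: uG; apply: ug_ladic_continuous; exact: ext_fun_continuous.
- move=> i; apply: (uG _ (mult_of (pu_coordM theta i))).
  by apply: ug_ladic_continuous; exact: theta_i.
move=> ext_le g g_pt g_lin x; apply: pu_pt_eq => i; apply: val_inj.
have [r [D gD]] := g_lin i.
rewrite gD [LHS]lin_image_regular.
(* The coordinate of [g] is linear in the entries of [r], so its composite with the extension is
   continuous and may be compared with [theta] on T alone. *)
apply: (continuous_eq C_pow C_mul_dvd (e := fun x => lin_image D (ext_fun r x))
  (f := fun x => val (val (theta x) i))) => [||t].
- exact/lin_image_continuous/ext_fun_continuous.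
- exact: theta_i.
- rewrite ext_fun_of -(model_mx_pt iota t r) -[LHS]lin_image_regular -gD g_pt.
  by [].
Qed.

End LadicCompletion.

(** All three groups are compared with one and the same model, which cancels in the middle of a
    composite; hence the three isomorphisms commute. *)
Theorem theoremA6 (l : nat) (l_prime : prime l)
    (T : groupType) (T_fg : finitely_generated T)
    (G : prounipGroup rat)
    (theta : {multiplicative T -> G rat^o})
    (theta_univ : is_unip_completion theta)
    (Gl : prounipGroup (padic l_prime))
    (theta_l : {multiplicative pro_completion l T -> Gl (padic l_prime)^o})
    (theta_l_univ : is_ladic_unip_completion theta_l)
    (Gh : prounipGroup (padic l_prime))
    (theta_h : {multiplicative profinite_completion T -> Gh (padic l_prime)^o})
    (theta_h_univ : is_ladic_unip_completion theta_h) :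
  let G_Ql := base_change (padic_of_rat l_prime) G in
  let from_T := base_change_pt (padic_of_rat l_prime) G \o theta in
  let from_T_l := theta_l \o @completion_of T _ in
  let from_T_h := theta_h \o @completion_of T _ in
  exists (a : gfHom G_Ql Gl) (b : gfHom G_Ql Gh) (c : gfHom Gh Gl),
    [/\ canonical_iso from_T from_T_l a,
        canonical_iso from_T from_T_h b,
        canonical_iso from_T_h from_T_l c &
        forall R : comAlgType (padic l_prime), a R =1 c R \o b R].
Proof.
move=> G_Ql from_T from_T_l from_T_h.
pose iota : {rmorphism rat -> padic l_prime} := padic_of_rat l_prime.
have [f [f' [fK f'K fP]]] : model_iso iota from_T.
  exact/model_iso_base_change/model_iso_discrete.
have [p [p' [pK p'K pP]]] : model_iso iota from_T_l.
  apply: (@model_iso_ladic _ _ _ iota T (fun m => exists e, m = l ^ e)%N T_fg _ _ _ theta_l).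
  - by move=> e; exists e.
  - move=> m n d [a ->] [b ->]; rewrite -expnD => /(dvdn_pfactor _ _ l_prime)[e _ ->].
    by exists e.
  - exact: theta_l_univ.
have [h [h' [hK h'K hP]]] : model_iso iota from_T_h.
  exact: (@model_iso_ladic _ _ _ iota T (fun=> True) T_fg _ _ _ theta_h).
exists (gf_comp f p'), (gf_comp f h'), (gf_comp h p'); split.
- exact: (canonical_iso_model fK f'K fP pK p'K pP).
- exact: (canonical_iso_model fK f'K fP hK h'K hP).
- exact: (canonical_iso_model hK h'K hP pK p'K pP).
- by move=> R x; rewrite /= h'K.
Qed.
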